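(* Let $g:[0,1]\times E\to\mathbb R$ be bounded and measurable and assume: (i) there is $L>0$ such that $\sup_{x\in E}\|\delta_xQ_u-\delta_xQ_v\|_{\mathrm{TV}}\le L|u-v|$ for all $u,v\in[0,1]$; (ii) there are an integer $m\ge 1$ and $r\in(0,1)$ such that $\sup_{u\in[0,1]}\sup_{x,y\in E}\|\delta_xQ_u^m-\delta_yQ_u^m\|_{\mathrm{TV}}\le r$; (iii) there is $K<\infty$ such that $\sup_{u\in[0,1]}\|g(u,\cdot)\|_\infty\le K$; (iv) there is $C_g\ge 0$ such that $|g(u,x)-g(v,x)|\le C_g|u-v|$ for all $u,v\in[0,1]$, $x\in E$. (1) For $u\in[0,1]$ set $b_u=\int_E g(u,x)\,d\pi_u(x)$ and let $b=\int_0^1 b_u\,du$. Then $\lim_{n\to\infty}\frac1n\mathbb E[S_n]=b$, and moreover $\sup_n|\mathbb E[S_n]-nb|<\infty$. (2) Let $(Y_{j,u})_{j\ge0}$ be the stationary Markov chain with transition operator $Q_u$ and set, for $u\in[0,1]$, $$a_u^2=\lim_{n\to\infty}\frac1n\operatorname{Var}\Big(\sum_{j=1}^n g(u,Y_{j,u})\Big)=\int_E\tilde g^2(u,x)\,d\pi_u(x)+2\sum_{j=1}^\infty\int_E\tilde g(u,x)\big(Q_u^j(\tilde g(u,\cdot))\big)(x)\,d\pi_u(x),$$ where $\tilde g(u,x)=g(u,x)-\int_E g(u,y)\,d\pi_u(y)$. Let $a^2=\int_0^1a_u^2\,du$. Then $$\lim_{n\to\infty}\frac1n\operatorname{Var}(S_n)=a^2,\qquad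 \sup_n|\operatorname{Var}(S_n)-na^2|<\infty,\qquad \sup_n\big|\mathbb E[(S_n-bn)^2]-na^2\big|<\infty.$$ Finally, if there is $\delta>0$ such that $r(Q_{u,it})<1$ for every $u\in[0,1]$ and every real $t$ with $0<|t|<\delta$ (in particular if $r(Q_{u,it})<1$ for all $u\in[0,1]$ and all real $t\ne0$), then $a_u^2>0$ for every $u\in[0,1]$, and in particular $a^2>0$.
   Context: $(E,d)$ is a metric space with Borel $\sigma$-algebra $\mathcal B(E)$ and $\{Q_u:u\in[0,1]\}$ is a family of Markov transition kernels on $(E,\mathcal B(E))$. $\mathfrak B$ is the Banach space of bounded $\mathcal B(E)$-measurable functions $f:E\to\mathbb C$ with the supremum norm $\|\cdot\|_\infty$. For probability measures, $\|\mu-\nu\|_{\mathrm{TV}}=\sup_{\|f\|_\infty\le1}|\int f\,d\mu-\int f\,d\nu|=2\sup_{A\in\mathcal B(E)}|\mu(A)-\nu(A)|$; $\delta_x$ is the Dirac mass at $x$. Under (i)-(ii) each $Q_u$ has a unique invariant probability measure, denoted $\pi_u$; the stationary chain with transition operator $Q_u$ is the one with initial law $\pi_u$. For each $n\ge1$, $X_{n,0},X_{n,1},\dots,X_{n,n}$ is an inhomogeneous Markov chain on $E$ with $X_{n,0}\sim\pi_0$ (the measure $\pi_u$ at $u=0$) and $\mathbb P(X_{n,k}\in A\mid X_{n,k-1}=x)=Q_{k/n}(x,A)$ for $1\le k\le n$. Set $S_n=\sum_{k=1}^n g(k/n,X_{n,k})$. For $z\in\mathbb C$, the twisted operator $Q_{u,z}$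 on $\mathfrak B$ is $Q_{u,z}f(x)=\int e^{zg(u,y)}f(y)\,Q_u(x,dy)$; $r(\cdot)$ applied to an operator denotes its spectral radius on $\mathfrak B$. *)

(* Defs.v *)
From HB Require Import structures.
From mathcomp Require Export all_boot all_order all_algebra.
From mathcomp Require Export all_classical all_reals all_analysis.
From mathcomp.real_closed Require Export complex.

Set Implicit Arguments.
Unset Strict Implicit.
Unset Printing Implicit Defensive.

Import Order.TTheory GRing.Theory Num.Theory.
Import numFieldNormedType.Exports.

Local Open Scope classical_set_scope.
Local Open Scope ring_scope.
Local Open Scope complex_scope.

(* [measurableType] requires a distinguished point, so a metric space carrying
   a Borel sigma-algebra has to be pointed, i.e. nonempty. *)
#[short(type="pmetricType")]
HB.structure Definition PointedMetric (R : numDomainType) :=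
  {M of PseudoPointedMetric R M & PseudoMetric_isMetric R M}.

Notation borel E := (g_sigma_algebraType (@open E)).

Section total_variation_distance.
Context d (E : measurableType d) (R : realType).

(* Normalised to take values in [0, 2] on probability measures. *)
Definition tv_dist (mu nu : {measure set E -> \bar R}) : \bar R :=
  ereal_sup [set `| \int[mu]_x f x - \int[nu]_x f x |%:E | f in
    [set f : E -> R | measurable_fun setT f /\ forall x, `|f x| <= 1]].

End total_variation_distance.

Section kernels.
Context d (E : measurableType d) (R : realType).

Fixpoint kiter (Q : R.-spker E ~> E) (m : nat) : R.-spker E ~> E :=
  if m is m'.+1 then mkcomp_noparam (kiter Q m') Q
  else kdirac (@measurable_id _ E setT).

Definition kact (Q : R.-spker E ~> E) (f : E -> R) (x : E) : R :=
  \int[Q x]_y f y.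

Definition invariant (Q : R.-pker E ~> E) (mu : probability E R) : Prop :=
  forall A : set E, measurable A -> (\int[mu]_x Q x A = mu A)%E.

End kernels.

Section markov_chains.
Context d (E : measurableType d) (R : realType) (dO : measure_display).
Context (Omega : measurableType dO) (P : probability Omega R).

Definition has_law (X : {RV P >-> E}) (mu : probability E R) : Prop :=
  forall A : set E, measurable A -> distribution P X A = mu A.

(* Markov property for the transition from time [k] to time [k.+1]:
   [K (X k) A] is a version of the conditional probability of the event
   [X k.+1 \in A] given the sigma-algebra generated by [X 0, ..., X k]. *)
Definition markov_step (X : nat -> {RV P >-> E}) (k : nat)
    (K : R.-pker E ~> E) : Prop :=
  forall (A : set E) (F : set Omega), measurable A ->
    g_sigma_preimage (fun i : 'I_k.+1 => (X i : Omega -> E)) F ->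
    (P (F `&` X k.+1 @^-1` A) = \int[P]_(w in F) K (X k w) A)%E.

Definition stationary_chain (Q : R.-pker E ~> E) (mu : probability E R)
    (Y : nat -> {RV P >-> E}) : Prop :=
  has_law (Y 0) mu /\ forall k, markov_step Y k Q.

End markov_chains.

(* The array [X n 0, ..., X n n]; only the rows [1 <= n], and in row [n] only
   the times [k <= n], are constrained. *)
Definition inhomogeneous_array d (E : measurableType d) (R : realType)
    (Q : R -> R.-pker E ~> E) (mu : probability E R)
    (dO : nat -> measure_display) (Omega : forall n, measurableType (dO n))
    (P : forall n, probability (Omega n) R)
    (X : forall n, nat -> {RV (P n) >-> E}) : Prop :=
  forall n, (1 <= n)%N ->
    has_law (X n 0) mu /\
    forall k, (k < n)%N -> markov_step (X n) k (Q (k.+1%:R / n%:R)).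

Definition array_sum d (E : measurableType d) (R : realType)
    (g : R -> E -> R)
    (dO : nat -> measure_display) (Omega : forall n, measurableType (dO n))
    (P : forall n, probability (Omega n) R)
    (X : forall n, nat -> {RV (P n) >-> E}) (n : nat) (w : Omega n) : R :=
  \sum_(1 <= k < n.+1) g (k%:R / n%:R) (X n k w).

(* Families over [0, 1] are indexed by all of [R]; the values at indices
   outside [0, 1] are never used. *)
Section stationary_quantities.
Context d (E : measurableType d) (R : realType).
Variables (Q : R -> R.-pker E ~> E) (pi : R -> probability E R).
Variable g : R -> E -> R.

Definition smean (u : R) : R := \int[pi u]_x g u x.

Definition gcent (u : R) (x : E) : R := g u x - smean u.

Definition autocov (u : R) (j : nat) : R :=
  \int[pi u]_x (gcent u x * kact (kiter (Q u) j) (gcent u) x).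

Definition autocov_series (u : R) : R^nat :=
  series (fun j => autocov u j.+1).

(* The series expression of the asymptotic variance [a_u^2]; it is meaningful
   only where [autocov_series] converges. *)
Definition avar (u : R) : R :=
  \int[pi u]_x (gcent u x ^+ 2) + 2 * limn (autocov_series u).

End stationary_quantities.

Section twisted_operators.
Context d (E : measurableType d) (R : realType).
Local Notation C := R[i].

Definition cexp (z : C) : C :=
  (expR (complex.Re z))%:C * (cos (complex.Im z) +i* sin (complex.Im z)).

Definition cintegral (mu : {measure set E -> \bar R}) (f : E -> C) : C :=
  (\int[mu]_x complex.Re (f x)) +i* (\int[mu]_x complex.Im (f x)).

(* The elements of the Banach space of bounded measurable functions; an operator
   on it is a map on [E -> C] of which only the values on [bmfun] matter. *)
Definition bmfun : set (E -> C) :=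
  [set f : E -> C | [/\ measurable_fun setT (fun x => complex.Re (f x)),
               measurable_fun setT (fun x => complex.Im (f x)) &
               exists M : R, forall x, Normc.normc (f x) <= M]].

Definition sup_norm (f : E -> C) : R :=
  sup [set Normc.normc (f x) | x in setT].

Definition bounded_operator (T : (E -> C) -> (E -> C)) : Prop :=
  [/\ forall f, bmfun f -> bmfun (T f),
      forall (c : C) f h, bmfun f -> bmfun h ->
        T (fun x => c * f x + h x) = (fun x => c * T f x + T h x) &
      exists M : R, forall f, bmfun f -> sup_norm (T f) <= M * sup_norm f].

(* [l - T] has a two-sided inverse among the bounded operators on [bmfun]. *)
Definition in_resolvent (T : (E -> C) -> (E -> C)) (l : C) : Prop :=
  exists S : (E -> C) -> (E -> C), bounded_operator S /\
    forall f, bmfun f ->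
      S (fun x => l * f x - T f x) = f /\
      (fun x => l * S f x - T (S f) x) = f.

Definition spectrum (T : (E -> C) -> (E -> C)) : set C :=
  [set l | ~ in_resolvent T l].

(* Supremum of the moduli over the spectrum, not the Gelfand limit. *)
Definition spectral_radius (T : (E -> C) -> (E -> C)) : \bar R :=
  ereal_sup [set (Normc.normc l)%:E | l in spectrum T].

Definition twisted (Q : R -> R.-pker E ~> E) (g : R -> E -> R) (u : R) (z : C)
    (f : E -> C) (x : E) : C :=
  cintegral (Q u x) (fun y => cexp (z * (g u y)%:C) * f y).

End twisted_operators.

(* Main.v *)
Require Import Defs.
From mathcomp Require Import measurable_realfun ring lra.

Set Implicit Arguments.
Unset Strict Implicit.
Unset Printing Implicit Defensive.

Import Order.TTheory GRing.Theory Num.Theory.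
Import numFieldNormedType.Exports.

Local Open Scope classical_set_scope.
Local Open Scope ring_scope.

(* Let h_u solve the Poisson equation h_u - Q_u h_u = g_u - pi_u(g_u); the
   Doeblin condition (ii) makes the Neumann series of h_u converge uniformly and
   makes h_u Lipschitz in u.  Along the chain, g_k(X_k) - pi_k(g_k) is the sum of
   the martingale difference D_k = h_k(X_k) - Q_k h_k (X_(k-1)) and of
   Q_k h_k (X_(k-1)) - Q_k h_k (X_k), and by Abel summation the latter terms add
   up to a bounded remainder.  Together with Riemann sums this gives (1).  For
   the variance, E[D_k^2] is up to telescoping the mean of
   h_u^2 - (Q_u h_u)^2, whose pi_u-mean is a_u^2, and the covariance of the
   martingale M_k with the remainder stays bounded because |E[M_k f(X_k)]| is at
   most a constant times the supremum of |f|, by contraction over m steps.  The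
   stationary chain is the case of a constant family.  If a_u^2 = 0 then
   h_u(y) = Q_u h_u(x) for almost every transition, so that exp(i t Q_u h_u) is
   almost everywhere an eigenfunction of Q_(u,it) for the unimodular value
   exp(i t pi_u(g_u)); as this value is not in the resolvent set, the spectral
   radius is at least 1. *)

(** * Bounded measurable functions *)

Section bounded_measurable.
Context d (T : measurableType d) (R : realType).
Implicit Types f g : T -> R.

(** The variance claim asks for a bounded distance to n a^2. The martingale has L^2 norm of order
    sqrt n, so Cauchy-Schwarz against the bounded remainder would leave an error of order sqrt n,
    enough for the limit only; hence the decorrelation estimate. There the m consecutive kernels of
    a row differ, and (ii) says nothing about their product. By (i) the product is within order m^2
    L / n of the m-th power of one frozen kernel, so it contracts once n is large; short rows are
    bounded directly. At the end, the eigenfunction relation may fail on a null set, which the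
    supremum norm does see, so the unimodular value need not be an eigenvalue. Iterating the
    normalised operator gives functions that agree almost everywhere; their sums grow linearly while
    the images of these sums stay bounded. Conditional expectations and almost sure statements are
    avoided: the Markov property is used through integrals of products, and almost everywhere
    equality as a vanishing integral of a modulus. *)

Definition bm f := measurable_fun setT f /\ exists M, forall x, `|f x| <= M.

Lemma bm_cst (c : R) : bm (fun=> c).
Proof. by split; [exact: measurable_cst|exists `|c|]. Qed.

Lemma bmD f g : bm f -> bm g -> bm (fun x => f x + g x).
Proof.
move=> [mf [A fA]] [mg [B gB]]; split; first exact: measurable_funD.
exists (A + B) => x; exact: le_trans (ler_normD _ _) (lerD _ _).
Qed.

Lemma bmM f g : bm f -> bm g -> bm (fun x => f x * g x).
Proof.
move=> [mf [A fA]] [mg [B gB]]; split; first exact: measurable_funM.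
by exists (A * B) => x; rewrite normrM ler_pM.
Qed.

Lemma bmN f : bm f -> bm (fun x => - f x).
Proof.
move=> [mf [A fA]]; split; last by exists A => x; rewrite normrN.
exact: measurableT_comp.
Qed.

Lemma bmB f g : bm f -> bm g -> bm (fun x => f x - g x).
Proof. by move=> bf bg; apply: bmD => //; exact: bmN. Qed.

Lemma bm_norm f : bm f -> bm (fun x => `|f x|).
Proof.
move=> [mf [A fA]]; split; last by exists A => x; rewrite normr_id.
exact: measurableT_comp.
Qed.

Lemma bmX f n : bm f -> bm (fun x => f x ^+ n).
Proof.
move=> bf; elim: n => [|n ih]; first exact: bm_cst.
by under eq_fun do rewrite exprS; exact: bmM.
Qed.

Lemma bm_sum I (s : seq I) (P : pred I) (F : I -> T -> R) :
  (forall i, bm (F i)) -> bm (fun x => \sum_(i <- s | P i) F i x).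
Proof.
move=> bF; elim: s => [|i s ih].
  by under eq_fun do rewrite big_nil; exact: bm_cst.
under eq_fun do rewrite big_cons.
by case: (P i) => //; exact: bmD.
Qed.

Lemma bm_indic (A : set T) : measurable A -> bm (\1_A).
Proof.
move=> mA; split; first exact: measurable_indic.
exists 1 => x; rewrite indicE; case: (_ \in _); rewrite ?normr1 ?normr0//.
Qed.

Lemma bm_approx f (g : nat -> T -> R) (e : nat -> R) :
  (forall n, bm (g n)) -> (forall n x, `|f x - g n x| <= e n) ->
  e n @[n --> \oo] --> 0 -> bm f.
Proof.
move=> bg fg e0; split.
  apply: (@measurable_fun_cvg _ _ _ setT g) => //.
    by move=> n; case: (bg n).
  move=> x _; apply/cvgrPdist_le => eps eps0.
  move/cvgrPdist_le : e0 => /(_ _ eps0); apply: filterS => n.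
  rewrite sub0r normrN; apply: le_trans; apply: le_trans (fg n x) (ler_norm _).
have [_ [A gA]] := bg 0%N.
exists (e 0%N + A) => x.
by rewrite -(subrK (g 0%N x) (f x)); exact: le_trans (ler_normD _ _) (lerD _ _).
Qed.

(** The sum counts the positive integers that do not exceed y, so it is the floor of y. This is the
    layer-cake approximation behind [bm_ind]. *)
Lemma count_levels (n : nat) (y : R) : 0 <= y -> y <= n%:R ->
  `|y - \sum_(i < n) ((i.+1%:R <= y)%R : nat)%:R| <= 1.
Proof.
move=> y0 yn.
(* The hypothesis y <= n is lost when n decreases; the lower bound truncated at n is stable under
   induction. *)
suff [A B] : \sum_(i < n) ((i.+1%:R <= y)%R : nat)%:R <= y /\
   Num.min y n%:R - 1 <= \sum_(i < n) ((i.+1%:R <= y)%R : nat)%:R :> R.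
  rewrite ger0_norm ?subr_ge0// lerBlDr.
  by move: B; rewrite min_l// lerBlDr addrC.
move: yn => _; elim: n => [|n [ih1 ih2]].
  by rewrite big_ord0 min_r//; split => //; rewrite sub0r oppr_le0.
have sn : \sum_(i < n) ((i.+1%:R <= y)%R : nat)%:R <= n%:R :> R.
  have <- : \sum_(i < n) 1 = n%:R :> R by rewrite sumr_const card_ord.
  apply: ler_sum => i _; rewrite -[leRHS]/(1%:R) ler_nat.
  by case: (i.+1%:R <= y).
rewrite big_ord_recr/=; have [ny|ny] /= := leP n.+1%:R y.
  split; first by apply: le_trans ny; rewrite -[leRHS]natr1; apply: lerD.
  rewrite -[n.+1%:R]natr1 addrK; move: ih2; rewrite min_r ?lerBlDr//.
  by apply: le_trans ny; rewrite ler_nat.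
rewrite addr0; split=> //; move: ih2; have [ny'|ny'] := leP y n%:R => // ih2.
have e1 (i : 'I_n) : (i.+1%:R <= y)%R = true.
  by apply: le_trans (ltW ny'); rewrite ler_nat.
under eq_bigr => i _ do rewrite e1.
by rewrite sumr_const card_ord lerBlDr natr1; exact: ltW.
Qed.


(** A monotone class principle in which uniform limits replace monotone ones: a bounded measurable
    function is a uniform limit of combinations of indicators of its level sets. *)
Lemma bm_ind (P : (T -> R) -> Prop) :
  (forall A, measurable A -> P \1_A) ->
  (forall c f g, bm f -> bm g -> P f -> P g -> P (fun x => c * f x + g x)) ->
  (forall f, bm f ->
    (forall e, 0 < e -> exists g, [/\ bm g, P g & forall x, `|f x - g x| <= e]) ->
    P f) ->
  forall f, bm f -> P f.
Proof.
move=> P1 PD Plim.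
have P0 : P (fun=> 0).
  have -> : (fun=> 0) = \1_(@set0 T) :> (T -> R); last exact: P1.
  by apply/funext => x; rewrite indicE in_set0.
have Pc c : P (fun=> c).
  have -> : (fun=> c) = (fun x : T => c * \1_[set: T] x + 0) :> (T -> R).
    by apply/funext => x; rewrite indicE in_setT mulr1 addr0.
  by apply: PD => //; [exact: bm_indic|exact: bm_cst|exact: P1].
move=> f bf; have [mf [M fM]] := bf; apply: Plim => // e e0.
have M0 : 0 <= M by apply: le_trans (fM point); exact: normr_ge0.
(* Levels are spaced by e; after the shift by M the values lie in [0, 2 M], so 2 M / e levels
   suffice. *)
pose q : R := e^-1.
have q0 : 0 < q by rewrite invr_gt0.
have [n nM] : exists n : nat, 2 * q * M <= n%:R.
  exists (Num.truncn (2 * q * M)).+1; apply: ltW; exact: truncnS_gt.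
pose A (i : nat) := [set x | i.+1%:R <= q * (f x + M)].
have mA i : measurable (A i).
  have mle : measurable_fun setT (fun x => i.+1%:R <= q * (f x + M)).
    apply: measurable_fun_ler; first exact: measurable_cst.
    by apply: measurable_funM => //; apply: measurable_funD.
  by have := mle measurableT [set true] I; rewrite setTI.
pose s n x : R := \sum_(i < n) \1_(A i) x.
have bs k : bm (s k) by apply: bm_sum => i; exact: bm_indic.
have Ps k : P (s k).
  elim: k => [|k ih].
    by have -> : s 0%N = (fun=> 0) by apply/funext => x; rewrite /s big_ord0.
  have -> : s k.+1 = (fun x => 1 * s k x + \1_(A k) x).
    by apply/funext => x; rewrite /s big_ord_recr/= mul1r.
  by apply: PD => //; [exact: bm_indic|exact: P1].
exists (fun x => e * s n x + (- M)); split.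
- by apply: bmD; [apply: bmM => //|]; exact: bm_cst.
- by apply: PD => //; exact: bm_cst.
- move=> x; have := fM x; rewrite ler_norml => /andP[fl fu].
  have := @count_levels n (q * (f x + M)) _ _.
  rewrite pmulr_rge0// -lerBlDr sub0r => /(_ fl).
  have qn : q * (f x + M) <= n%:R.
    apply: le_trans nM; rewrite (mulrC 2) -mulrA ler_pM2l//.
    by rewrite mulr_natl mulr2n lerD2r.
  move=> /(_ qn).
  have -> : \sum_(i < n) ((i.+1%:R <= q * (f x + M))%R : nat)%:R = s n x.
    apply: eq_bigr => i _; rewrite indicE; congr ((nat_of_bool _)%:R).
    by apply/idP/idP; rewrite inE.
  have -> : f x - (e * s n x - M) = e * (q * (f x + M) - s n x).
    by rewrite /q; field; rewrite gt_eqF.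
  by move=> h; rewrite normrM (gtr0_norm e0) -[leRHS]mulr1 ler_pM2l.
Qed.

End bounded_measurable.

Section bounded_integral.
Context d (T : measurableType d) (R : realType).
Variables (mu : {measure set T -> \bar R}) (mu1 : mu setT = 1%E).
Implicit Types f g : T -> R.

Lemma bm_integrable f : bm f -> mu.-integrable setT (EFin \o f).
Proof.
move=> [mf [M fM]]; apply: measurable_bounded_integrable => //.
  by rewrite mu1 ltry.
exists M; split; first by rewrite num_real.
by move=> x Mx y _ /=; exact: le_trans (fM y) (ltW Mx).
Qed.

Lemma int_EFin f : bm f -> (\int[mu]_x (f x)%:E = (\int[mu]_x f x)%:E)%E.
Proof.
move=> bf; rewrite /Rintegral fineK//.
by apply: integrable_fin_num => //; exact: bm_integrable.
Qed.

Lemma intD f g : bm f -> bm g ->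
  \int[mu]_x (f x + g x) = \int[mu]_x f x + \int[mu]_x g x.
Proof. by move=> bf bg; rewrite RintegralD//; exact: bm_integrable. Qed.

Lemma intB f g : bm f -> bm g ->
  \int[mu]_x (f x - g x) = \int[mu]_x f x - \int[mu]_x g x.
Proof. by move=> bf bg; rewrite RintegralB//; exact: bm_integrable. Qed.

Lemma intZ c f : bm f -> \int[mu]_x (c * f x) = c * \int[mu]_x f x.
Proof. by move=> bf; rewrite RintegralZl//; exact: bm_integrable. Qed.

Lemma int_cst c : \int[mu]_x c = c.
Proof. by rewrite Rintegral_cst// mu1 /= mulr1. Qed.

Lemma int_eq0 f : (forall x, f x = 0) -> \int[mu]_x f x = 0.
Proof. by move=> f0; under eq_Rintegral do rewrite f0; exact: int_cst. Qed.

Lemma int_sum n (F : nat -> T -> R) : (forall i, bm (F i)) ->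
  \int[mu]_x (\sum_(i < n) F i x) = \sum_(i < n) \int[mu]_x F i x.
Proof.
move=> bF; elim: n => [|n ih].
  by rewrite big_ord0; under eq_Rintegral do rewrite big_ord0; rewrite int_cst.
rewrite big_ord_recr/= -ih -intD//; last exact: bm_sum.
by apply: eq_Rintegral => x _; rewrite big_ord_recr.
Qed.

Lemma int_le f g : bm f -> bm g -> (forall x, f x <= g x) ->
  \int[mu]_x f x <= \int[mu]_x g x.
Proof. by move=> bf bg fg; apply: le_Rintegral => //; exact: bm_integrable. Qed.

Lemma int_norm f : bm f -> `|\int[mu]_x f x| <= \int[mu]_x `|f x|.
Proof. by move=> bf; apply: le_normr_Rintegral => //; exact: bm_integrable. Qed.

Lemma int_bound f M : bm f -> (forall x, `|f x| <= M) -> `|\int[mu]_x f x| <= M.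
Proof.
move=> bf fM; rewrite -[leRHS](int_cst M); apply: le_trans (int_norm bf) _.
by apply: int_le => //; [exact: bm_norm|exact: bm_cst].
Qed.

Lemma int_dist f g e : bm f -> bm g -> (forall x, `|f x - g x| <= e) ->
  `|\int[mu]_x f x - \int[mu]_x g x| <= e.
Proof. by move=> bf bg fg; rewrite -intB//; apply: int_bound => //; exact: bmB. Qed.

Lemma int_indic (A : set T) : measurable A -> \int[mu]_x \1_A x = fine (mu A).
Proof. by move=> mA; rewrite /Rintegral integral_indic// setIT. Qed.

End bounded_integral.

(** * Kernels acting on bounded functions *)

Section kernel_action.
Context d (E : measurableType d) (R : realType).
Implicit Types f g : E -> R.

Lemma eq_of_dist_le (a b : R) : (forall e, 0 < e -> `|a - b| <= 2 * e) -> a = b.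
Proof.
move=> h; apply/eqP; rewrite -subr_eq0 -normr_le0; apply/ler_addgt0Pl => e e0.
by rewrite addr0; have := h (e / 2); rewrite divr_gt0// mulrC divfK//; apply.
Qed.

(** Linearity and Lipschitz continuity for the supremum norm carry equality from indicators to all
    bounded measurable functions through [bm_ind]. Chapman-Kolmogorov, invariance and the Markov
    property are all lifted from sets to functions in this way. *)
Lemma eq_linear_functional d' (T : measurableType d') (I J : (T -> R) -> R) :
  (forall A, measurable A -> I \1_A = J \1_A) ->
  (forall c (f g : T -> R), bm f -> bm g -> I (fun x => c * f x + g x) = c * I f + I g) ->
  (forall c (f g : T -> R), bm f -> bm g -> J (fun x => c * f x + g x) = c * J f + J g) ->
  (exists c, 0 < c /\ forall (f g : T -> R) e, bm f -> bm g -> (forall x, `|f x - g x| <= e) ->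
     `|I f - I g| <= c * e /\ `|J f - J g| <= c * e) ->
  forall f : T -> R, bm f -> I f = J f.
Proof.
move=> h1 hI hJ [c [c0 hc]]; apply: bm_ind => //.
  by move=> a f g bf bg ef eg; rewrite hI// hJ// ef eg.
move=> f bf h; apply: eq_of_dist_le => e e0.
have [g [bg eg fg]] := h (e / c) (divr_gt0 e0 c0).
have [a1 a2] := hc _ _ _ bf bg fg.
have -> : I f - J f = (I f - I g) - (J f - J g) by rewrite eg opprB addrA subrK.
apply: le_trans (ler_normB _ _) _; rewrite mulr_natl mulr2n.
by move: a1 a2; rewrite mulrC divfK ?gt_eqF// => a1 a2; exact: lerD.
Qed.

Section one_kernel.
Variables (K : R.-spker E ~> E) (K1 : forall x, K x setT = 1%E).

Lemma bm_kact f : bm f -> bm (kact K f).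
Proof.
move: f; apply: bm_ind.
- move=> A mA; split.
    rewrite (_ : kact K \1_A = fine \o (K ^~ A)); last first.
      by apply/funext => x; rewrite /kact int_indic.
    by apply: measurableT_comp => //; exact: measurable_kernel.
  exists 1 => x; apply: int_bound => //; first exact: bm_indic.
  move=> y; rewrite indicE; case: (_ \in _); rewrite ?normr1 ?normr0//.
- move=> c f g bf bg bKf bKg.
  rewrite (_ : kact _ _ = fun x => c * kact K f x + kact K g x).
    by apply: bmD => //; apply: bmM => //; exact: bm_cst.
  apply/funext => x; rewrite /kact intD//; first by rewrite intZ.
  by apply: bmM => //; exact: bm_cst.
- move=> f bf h.
  have /choice[g gP] n := h n.+1%:R^-1 (ltac:(by rewrite invr_gt0)).
  apply: (@bm_approx _ _ _ _ (fun n => kact K (g n)) (fun n => n.+1%:R^-1)).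
  + by move=> n; case: (gP n).
  + by move=> n x; have [bg _ fg] := gP n; apply: int_dist.
  + exact: cvg_harmonic.
Qed.

End one_kernel.

Section kiter_mass.
Variable Q : R.-spker E ~> E.
Hypothesis Q1 : forall x, Q x setT = 1%E.

Lemma kiter_setT m x : kiter Q m x setT = 1%E.
Proof.
elim: m => [|m ih] /=; first by rewrite /kdirac/= diracT.
rewrite -[LHS]/(\int[kiter Q m x]_y Q y setT)%E.
under eq_integral do rewrite Q1.
by rewrite integral_cst// mul1e ih.
Qed.

Lemma kact_kiter m f : bm f -> kact (kiter Q m) f = iter m (kact Q) f.
Proof.
elim: m f => [|m ih] f bf.
  apply/funext => x; rewrite /kact /= /Rintegral/= integral_dirac// ?diracT ?mul1e//.
  by apply/measurable_EFinP; case: bf.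
(* [kiter] appends the new transition last in time, so on functions it acts first. *)
rewrite iterSr -ih; last exact: bm_kact.
apply/funext => x; move: f bf; apply: eq_linear_functional.
- move=> A mA; rewrite /kact (int_indic _ mA).
  rewrite -[kiter Q m.+1 x A]/(\int[kiter Q m x]_y Q y A)%E.
  under eq_Rintegral do rewrite int_indic//.
  rewrite /Rintegral; congr fine; apply: eq_integral => y _.
  by rewrite fineK//; exact: finite_kernel_measure.
- by move=> c f g bf bg; rewrite /kact (intD (kiter_setT m.+1 x)) ?(intZ (kiter_setT m.+1 x))//; apply: bmM => //; exact: bm_cst.
- move=> c f g bf bg; rewrite {1 3 5}/kact.
  under eq_Rintegral.
    move=> y _; rewrite /kact intD ?intZ//; last by apply: bmM => //; exact: bm_cst.
    over.
  rewrite intD ?intZ//; try exact: kiter_setT; try exact: bm_kact.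
  by apply: bmM => //; [exact: bm_cst|exact: bm_kact].
- exists 1; split => // f g e bf bg fg; rewrite mul1r; split.
    exact: (int_dist (kiter_setT m.+1 x)).
  apply: int_dist; try exact: kiter_setT; try exact: bm_kact.
  by move=> y; apply: int_dist.
Qed.

End kiter_mass.

End kernel_action.

(** * Markov property on functions *)

#[local] Hint Extern 0 (_ = 1%E) => solve [exact: prob_kernel | exact: probability_setT] : core.

Section markov_functions.
Context d (E : measurableType d) (R : realType) (dO : measure_display).
Context (Omega : measurableType dO) (P : probability Omega R).
Implicit Types f g : E -> R.

Lemma bm_RV (X : {RV P >-> E}) f : bm f -> bm (fun w => f (X w)).
Proof.
move=> [mf [M fM]]; split; last by exists M => w.
by apply: (measurableT_comp mf); exact: measurable_funPT.
Qed.

Variables (X : nat -> {RV P >-> E}) (k : nat) (K : R.-pker E ~> E).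
Hypothesis step : markov_step X k K.

Lemma markov_step_indic j (A B : set E) : (j <= k)%N ->
  measurable A -> measurable B ->
  \int[P]_w (\1_B (X j w) * \1_A (X k.+1 w)) =
  \int[P]_w (\1_B (X j w) * kact K \1_A (X k w)).
Proof.
move=> jk mA mB.
have mXj : measurable (X j @^-1` B).
  by rewrite -[X in measurable X]setTI; exact: measurable_funPT.
have mXk : measurable (X k.+1 @^-1` A).
  by rewrite -[X in measurable X]setTI; exact: measurable_funPT.
have FX : g_sigma_preimage (fun i : 'I_k.+1 => (X i : Omega -> E)) (X j @^-1` B).
  apply: sub_sigma_algebra; rewrite -bigcup_mkord_ord.
  exists j; first by rewrite /= ltnS.
  by exists B => //; rewrite inordK ?ltnS// setTI.
transitivity (fine (P (X j @^-1` B `&` X k.+1 @^-1` A))).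
  rewrite -int_indic; last exact: measurableI.
  by apply: eq_Rintegral => w _; rewrite indicI !indicE.
rewrite (step mA FX) /Rintegral; congr fine.
rewrite [LHS]integral_mkcond; apply: eq_integral => w _.
rewrite patchE /kact int_indic// indicE.
have -> : (w \in X j @^-1` B) = (X j w \in B) by apply/idP/idP; rewrite !inE.
case: (X j w \in B); last by rewrite mul0r.
by rewrite mul1r fineK//; exact: finite_kernel_measure.
Qed.

(** Two passes of [eq_linear_functional] over the case of indicators: one in f with p an indicator,
    then one in p. *)
Lemma markov_step_int j (p f : E -> R) : (j <= k)%N -> bm p -> bm f ->
  \int[P]_w (p (X j w) * f (X k.+1 w)) =
  \int[P]_w (p (X j w) * kact K f (X k w)).
Proof.
move=> jk; have P1 := @probability_setT _ _ _ P.
have K1 := @prob_kernel _ _ _ _ _ K.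
have bX f' i : bm f' -> bm (fun w => f' (X i w)) by exact: bm_RV.
have bK f' : bm f' -> bm (kact K f') by exact: bm_kact.
have KD c f1 g1 : bm f1 -> bm g1 ->
    kact K (fun x => c * f1 x + g1 x) = fun x => c * kact K f1 x + kact K g1 x.
  move=> bf bg; apply/funext => x.
  by rewrite /kact intD// ?intZ//; apply: bmM => //; exact: bm_cst.
have KB f1 g1 e x : bm f1 -> bm g1 -> (forall y, `|f1 y - g1 y| <= e) ->
    `|kact K f1 x - kact K g1 x| <= e.
  by move=> *; apply: int_dist.
have key B : measurable B -> forall f, bm f ->
    \int[P]_w (\1_B (X j w) * f (X k.+1 w)) =
    \int[P]_w (\1_B (X j w) * kact K f (X k w)).
  move=> mB; have bB : bm (\1_B : E -> R) by exact: bm_indic.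
  have B1 x : `|\1_B x| <= 1 :> R.
    by rewrite indicE; case: (_ \in _); rewrite ?normr1 ?normr0.
  apply: eq_linear_functional.
  - by move=> A mA; exact: markov_step_indic.
  - move=> c f1 g1 bf bg; rewrite -intZ// -?intD//.
    + by apply: eq_Rintegral => w _; ring.
    + by apply: bmM; [exact: bm_cst|apply: bmM; exact: bX].
    + by apply: bmM; exact: bX.
    + by apply: bmM; exact: bX.
  - move=> c f1 g1 bf bg; rewrite KD// -intZ// -?intD//.
    + by apply: eq_Rintegral => w _; ring.
    + by apply: bmM; [exact: bm_cst|apply: bmM; apply: bX => //; exact: bK].
    + by apply: bmM; apply: bX => //; exact: bK.
    + by apply: bmM; apply: bX => //; exact: bK.
  - exists 1; split=> // f1 g1 e bf bg fg; rewrite mul1r; split.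
    + apply: int_dist => //; [by apply: bmM; exact: bX..|move=> w].
      by rewrite -mulrBr normrM -[leRHS]mul1r ler_pM.
    + apply: int_dist => //; [by apply: bmM; apply: bX => //; exact: bK..|move=> w].
      rewrite -mulrBr normrM -[leRHS]mul1r ler_pM//; exact: KB.
move=> bp bf; have [_ [M fM]] := bf.
have fM' x : `|kact K f x| <= M by apply: int_bound.
have M0 : 0 <= M by apply: le_trans (fM point).
move: p bp; apply: eq_linear_functional.
- by move=> A mA; exact: key.
- move=> c f1 g1 bf1 bg1; rewrite -intZ// -?intD//.
  + by apply: eq_Rintegral => w _; ring.
  + by apply: bmM; [exact: bm_cst|apply: bmM; exact: bX].
  + by apply: bmM; exact: bX.
  + by apply: bmM; exact: bX.
- move=> c f1 g1 bf1 bg1; rewrite -intZ// -?intD//.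
  + by apply: eq_Rintegral => w _; ring.
  + by apply: bmM; [exact: bm_cst|apply: bmM; apply: bX => //; exact: bK].
  + by apply: bmM; apply: bX => //; exact: bK.
  + by apply: bmM; apply: bX => //; exact: bK.
(* A bound on f is a Lipschitz constant in p; adding 1 makes it positive even when f vanishes. *)
- exists (M + 1); split=> [|f1 g1 e bf1 bg1 fg]; first by rewrite ltr_wpDl.
  have e0 : 0 <= e by apply: le_trans (fg point).
  split.
  + apply: int_dist => //; [by apply: bmM; exact: bX..|move=> w].
    rewrite -mulrBl normrM mulrC ler_pM//.
    by apply: le_trans (fM _) _; rewrite lerDl.
  + apply: int_dist => //; [by apply: bmM; apply: bX => //; exact: bK..|move=> w].
    rewrite -mulrBl normrM mulrC ler_pM//.
    by apply: le_trans (fM' _) _; rewrite lerDl.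
Qed.

End markov_functions.

(** * Poisson equation *)

Section ergodic_kernel.
Context d (E : measurableType d) (R : realType).
Variables (Q : R.-pker E ~> E) (mu : probability E R) (m : nat) (r : R).
Hypotheses (Qmu : invariant Q mu) (m0 : (0 < m)%N) (r0 : 0 <= r) (r1 : r < 1).
Hypothesis contract : forall f (M : R), bm f -> (forall x, `|f x| <= M) ->
  forall x y, `|iter m (kact Q) f x - iter m (kact Q) f y| <= r * M.
Implicit Types f g F D : E -> R.
Local Notation T := (kact Q).

Let Q1 x : Q x setT = 1%E. Proof. exact: prob_kernel. Qed.
Let mu1 : mu setT = 1%E. Proof. exact: probability_setT. Qed.

Lemma kactD f g : bm f -> bm g -> T (fun x => f x + g x) = fun x => T f x + T g x.
Proof. by move=> bf bg; apply/funext => x; rewrite /kact intD. Qed.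

Lemma kactB f g : bm f -> bm g -> T (fun x => f x - g x) = fun x => T f x - T g x.
Proof. by move=> bf bg; apply/funext => x; rewrite /kact intB. Qed.

Lemma kactZ c f : bm f -> T (fun x => c * f x) = fun x => c * T f x.
Proof. by move=> bf; apply/funext => x; rewrite /kact intZ. Qed.

Lemma kact_cst c : T (fun=> c) = fun=> c.
Proof. by apply/funext => x; rewrite /kact int_cst. Qed.

Lemma kact_bound f M : bm f -> (forall x, `|f x| <= M) -> forall x, `|T f x| <= M.
Proof. by move=> bf fM x; apply: int_bound. Qed.

Lemma bm_pkact f : bm f -> bm (T f). Proof. exact: bm_kact. Qed.

Lemma bm_iter j f : bm f -> bm (iter j T f).
Proof. by move=> bf; elim: j => //= j ih; exact: bm_pkact. Qed.

Lemma iter_bound j f M : bm f -> (forall x, `|f x| <= M) ->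
  forall x, `|iter j T f x| <= M.
Proof.
move=> bf fM; elim: j => //= j ih x; apply: kact_bound => //; exact: bm_iter.
Qed.

Lemma iterB j f g : bm f -> bm g ->
  iter j T (fun x => f x - g x) = fun x => iter j T f x - iter j T g x.
Proof. by move=> bf bg; elim: j => //= j ->; rewrite kactB//; exact: bm_iter. Qed.

Lemma iter_cst j c : iter j T (fun=> c) = fun=> c.
Proof. by elim: j => //= j ->; rewrite kact_cst. Qed.

Lemma invariant_int f : bm f -> \int[mu]_x T f x = \int[mu]_x f x.
Proof.
move: f; apply: eq_linear_functional.
- move=> A mA; rewrite [RHS]int_indic//.
  transitivity (fine (\int[mu]_x Q x A)%E); last by rewrite Qmu.
  rewrite /Rintegral; congr fine.
  apply: eq_integral => x _; rewrite /kact int_indic// fineK//.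
  exact: finite_kernel_measure.
- move=> c f g bf bg; have bcf : bm (fun x => c * f x).
    by apply: bmM => //; exact: bm_cst.
  rewrite kactD// kactZ// intD ?intZ//; try exact: bm_pkact.
  by apply: bmM; [exact: bm_cst|exact: bm_pkact].
- move=> c f g bf bg; rewrite intD ?intZ//.
  by apply: bmM => //; exact: bm_cst.
- exists 1; split=> // f g e bf bg fg; rewrite mul1r; split; last exact: int_dist.
  apply: int_dist => //; try exact: bm_pkact.
  by move=> x; apply: int_dist.
Qed.

Lemma int_iter j f : bm f -> \int[mu]_x iter j T f x = \int[mu]_x f x.
Proof.
by move=> bf; elim: j => //= j <-; rewrite invariant_int//; exact: bm_iter.
Qed.

Lemma dist_int_le f M x : bm f -> (forall y, `|f x - f y| <= M) ->
  `|f x - \int[mu]_y f y| <= M.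
Proof.
move=> bf fM; rewrite -[X in `|X - _|](int_cst mu1) -intB//; last exact: bm_cst.
by apply: int_bound => //; apply: bmB => //; exact: bm_cst.
Qed.

(** Contraction is known over m steps only, so the rate is constant on blocks of m indices. *)
Definition geom (j : nat) : R := r ^+ (j %/ m).

Lemma geom_ge0 j : 0 <= geom j. Proof. exact: exprn_ge0. Qed.

Lemma geom_le i j : (i <= j)%N -> geom j <= geom i.
Proof.
by move=> ij; apply: ler_wiXn2l => //; [exact: ltW|exact: leq_div2r].
Qed.

Lemma geomDm j : geom (m + j) = r * geom j.
Proof. by rewrite /geom divnDl// divnn m0 add1n exprS. Qed.

(** The total of [geom] over all indices: m equal terms per block, with ratio r between blocks. *)
Definition cgeom : R := m%:R / (1 - r).

Lemma cgeom_ge0 : 0 <= cgeom.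
Proof. by apply: divr_ge0 => //; rewrite subr_ge0 ltW. Qed.

(* Shifting the index by [m] multiplies the sum by [r] and costs at most [m * geom N]. *)
Lemma sum_geom N n : \sum_(i < n) geom (N + i) <= cgeom * geom N.
Proof.
rewrite /cgeom mulrAC ler_pdivlMr ?subr_gt0// mulrBr mulr1 lerBlDr.
have -> : (\sum_(i < n) geom (N + i)) * r = \sum_(i < n) geom (N + (m + i)).
  by rewrite mulr_suml; apply: eq_bigr => i _; rewrite addnCA geomDm mulrC.
apply: (@le_trans _ _ (\sum_(i < m + n) geom (N + i))).
  rewrite addnC big_split_ord/= lerDl; apply: sumr_ge0 => i _; exact: geom_ge0.
rewrite big_split_ord/= lerD2r -[m in m%:R * _]card_ord mulr_natl -sumr_const.
by apply: ler_sum => i _; apply: geom_le; exact: leq_addr.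
Qed.

Lemma cvg_series_geom : cvgn (series geom).
Proof.
apply: nondecreasing_is_cvgn.
  by apply/nondecreasing_seqP => n; rewrite !seriesEnat/= big_nat_recr//= lerDl geom_ge0.
exists (cgeom * geom 0) => _ [n _ <-]; rewrite seriesEord/=.
exact: (sum_geom 0 n).
Qed.

Lemma cvg_geom : geom j @[j --> \oo] --> 0.
Proof. exact: cvg_series_cvg_0 cvg_series_geom. Qed.

Section poisson_equation.
Variables (F : E -> R) (M : R).
Hypotheses (bF : bm F) (FM : forall x, `|F x| <= M) (F0 : \int[mu]_x F x = 0).

Let M0 : 0 <= M. Proof. by apply: le_trans (FM point). Qed.

(** Invariance keeps the mean of each iterate at 0, so a value is at most the oscillation in
    modulus, and m further steps bring the oscillation below r times the previous supremum. Passing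
    from oscillation to supremum costs no factor. *)
Lemma iter_decay j x : `|iter j T F x| <= M * geom j.
Proof.
have key q i y : `|iter (q * m + i) T F y| <= M * r ^+ q.
  elim: q i y => [|q ih] i y; first by rewrite expr0 mulr1; exact: iter_bound.
  set G := iter (q * m + i) T F.
  have bG : bm G by exact: bm_iter.
  rewrite mulSn -addnA iterD -/G -[X in `|X|]subr0.
  have -> : 0 = \int[mu]_z iter m T G z by rewrite int_iter// int_iter// F0.
  apply: dist_int_le; first exact: bm_iter.
  by move=> z; rewrite exprS mulrCA; apply: contract => // y'; exact: ih.
by rewrite {1}(divn_eq j m); exact: key.
Qed.

Definition psum (N : nat) x := \sum_(i < N) iter i T F x.

Lemma bm_psum N : bm (psum N).
Proof. by apply: bm_sum => i; exact: bm_iter. Qed.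

Definition poisson (x : E) : R := limn (series (fun j => iter j T F x)).

Lemma cvg_psum x : psum N x @[N --> \oo] --> poisson x.
Proof.
have -> : (fun N => psum N x) = series (fun j => iter j T F x).
  by apply/funext => N; rewrite seriesEord.
apply: normed_cvg; apply: (@series_le_cvg _ _ (fun j => M * geom j)).
- by move=> j /=.
- by move=> j; rewrite mulr_ge0// geom_ge0.
- by move=> j; exact: iter_decay.
- have -> : series (fun j => M * geom j) = (fun n => M * series geom n).
    by apply/funext => n; rewrite !seriesEord/= mulr_sumr.
  by apply: is_cvgMr; exact: cvg_series_geom.
Qed.

Definition ptail N : R := cgeom * M * geom N.

Lemma ptail_ge0 N : 0 <= ptail N.
Proof.
by apply: mulr_ge0; [apply: mulr_ge0 => //; exact: cgeom_ge0|exact: geom_ge0].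
Qed.

Lemma cvg_ptail : ptail N @[N --> \oo] --> 0.
Proof. by rewrite -(mulr0 (cgeom * M)); apply: cvgMr; exact: cvg_geom. Qed.

Lemma poisson_approx N x : `|poisson x - psum N x| <= ptail N.
Proof.
have h n : `|psum (N + n) x - psum N x| <= ptail N.
  rewrite /psum big_split_ord/= addrAC subrr add0r.
  apply: le_trans (ler_norm_sum _ _ _) _.
  apply: (@le_trans _ _ (\sum_(i < n) (M * geom (N + i)))).
    by apply: ler_sum => i _; exact: iter_decay.
  rewrite -mulr_sumr /ptail mulrAC [leRHS]mulrC ler_wpM2l//; exact: sum_geom.
have c : `|psum (N + n) x - psum N x| @[n --> \oo] --> `|poisson x - psum N x|.
  apply: cvg_norm; apply: cvgB; last exact: cvg_cst.
  have := @cvg_psum x; rewrite -(cvg_shiftn N).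
  by under eq_fun do rewrite addnC.
rewrite -(cvg_lim _ c)//; apply: limr_le; last exact: nearW.
by apply/cvg_ex; eexists; exact: c.
Qed.

Lemma bm_poisson : bm poisson.
Proof.
by apply: (@bm_approx _ _ _ _ psum ptail); [exact: bm_psum|move=> *; exact: poisson_approx|
  exact: cvg_ptail].
Qed.

Lemma poisson_bound x : `|poisson x| <= cgeom * M.
Proof.
have := poisson_approx 0 x.
by rewrite /psum big_ord0 subr0 /ptail /geom div0n expr0 mulr1.
Qed.

Lemma eq_of_cvg0 (a b : R) (e : nat -> R) :
  (forall N, `|a - b| <= e N) -> e N @[N --> \oo] --> 0 -> a = b.
Proof.
move=> h e0; apply/eqP; rewrite -subr_eq0 -normr_le0.
by rewrite -(cvg_lim _ e0)//; apply: limr_ge; [apply/cvg_ex; eexists; exact: e0|exact: nearW].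
Qed.

Lemma kact_psum N x : T (psum N) x = psum N.+1 x - F x.
Proof.
rewrite /kact /psum int_sum//; last by move=> i; exact: bm_iter.
by rewrite [X in _ = X - _]big_ord_recl/= addrAC subrr add0r.
Qed.

Lemma poisson_eq x : poisson x - T poisson x = F x.
Proof.
apply: (@eq_of_cvg0 _ _ (fun N => ptail N.+1 + ptail N)).
  move=> N; have -> : poisson x - T poisson x - F x =
      (poisson x - psum N.+1 x) - (T poisson x - T (psum N) x).
    by rewrite kact_psum; ring.
  apply: le_trans (ler_normB _ _) _; apply: lerD; first exact: poisson_approx.
  apply: int_dist => //; [exact: bm_poisson|exact: bm_psum|].
  by move=> y; exact: poisson_approx.
rewrite -(addr0 0); apply: cvgD; last exact: cvg_ptail.
by rewrite (cvg_shiftS ptail); exact: cvg_ptail.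
Qed.

Lemma int_poisson : \int[mu]_x poisson x = 0.
Proof.
apply: (@eq_of_cvg0 _ _ ptail); last exact: cvg_ptail.
move=> N; have <- : \int[mu]_x psum N x = 0.
  rewrite int_sum//; last by move=> i; exact: bm_iter.
  by rewrite big1// => i _; rewrite int_iter.
apply: int_dist => //; [exact: bm_poisson|exact: bm_psum|].
by move=> y; exact: poisson_approx.
Qed.

(** The partial sum is the mean of [F * T (psum n)], and [psum n] converges uniformly to
    [poisson]. *)
Lemma cvg_autocov :
  series (fun j => \int[mu]_x (F x * iter j.+1 T F x)) n @[n --> \oo] -->
  \int[mu]_x (F x * T poisson x).
Proof.
have M0' := M0.
apply/cvgrPdist_le => e e0.
have := cvg_ptail => /cvgrPdist_le/(_ (e / (M + 1))).
rewrite divr_gt0 ?ltr_wpDl// => /(_ isT); apply: filterS => n.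
rewrite sub0r normrN ger0_norm ?ptail_ge0// => hn.
rewrite seriesEord/= -(@int_sum _ _ _ mu mu1 n (fun i x => F x * iter i.+1 T F x)); last first.
  by move=> i; apply: bmM => //; apply: bm_iter => //; exact: bm_pkact.
apply: int_dist => //.
- by apply: bmM => //; apply: bm_pkact; exact: bm_poisson.
- apply: bm_sum => i; apply: bmM => //; apply: bm_pkact; exact: bm_iter.
move=> x; rewrite -mulr_sumr -mulrBr normrM.
have -> : \sum_(i < n) T (iter i T F) x = T (psum n) x.
  by rewrite /kact int_sum// => i; exact: bm_iter.
have h : `|T poisson x - T (psum n) x| <= e / (M + 1).
  apply: le_trans hn; apply: int_dist => //; [exact: bm_poisson|exact: bm_psum|].
  by move=> y; exact: poisson_approx.
apply: (@le_trans _ _ ((M + 1) * (e / (M + 1)))).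
  by apply: ler_pM => //; apply: le_trans (FM x) _; rewrite lerDl.
by rewrite mulrC divfK// gt_eqF// ltr_wpDl.
Qed.

(** With h = [poisson] one has F = h - T h, hence F^2 + 2 F T h = (F + T h)^2 - (T h)^2 = h^2 - (T
    h)^2. *)
Lemma avar_poisson :
  \int[mu]_x (F x ^+ 2) + 2 * \int[mu]_x (F x * T poisson x) =
  \int[mu]_x (poisson x ^+ 2 - T poisson x ^+ 2).
Proof.
have bp := bm_poisson; have bTp := bm_pkact bp.
rewrite -intZ//; last exact: bmM.
rewrite -intD//; last by apply: bmM; [exact: bm_cst|exact: bmM].
  by apply: eq_Rintegral => x _; rewrite -poisson_eq; ring.
exact: bmX.
Qed.

End poisson_equation.

(** Quantitative uniqueness, up to constants, for the Poisson equation: D is within m e of its m-th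
    iterate, whose oscillation is at most r times that of D, so the oscillation o satisfies o <= 2 m
    e + r o. *)
Lemma osc_bound D e : bm D -> (forall x, `|D x - T D x| <= e) ->
  forall x y, `|D x - D y| <= 2 * cgeom * e.
Proof.
move=> bD De.
have e0 : 0 <= e by apply: le_trans (De point).
have itD j x : `|D x - iter j T D x| <= j%:R * e.
  elim: j x => [|j ih] x; first by rewrite subrr normr0 mul0r.
  have -> : D x - iter j.+1 T D x = (D x - T D x) + (T D x - T (iter j T D) x).
    by rewrite /=; ring.
  apply: le_trans (ler_normD _ _) _; rewrite -natr1 mulrDl mul1r addrC.
  apply: lerD => //; apply: int_dist => //; exact: bm_iter.
have step o : (forall x y, `|D x - D y| <= o) ->
    forall x y, `|D x - D y| <= 2 * (m%:R * e) + r * o.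
  move=> Do x y.
  have -> : D x - D y = (D x - iter m T D x) - (D y - iter m T D y) +
      (iter m T D x - iter m T D y) by ring.
  apply: le_trans (ler_normD _ _) _; apply: lerD.
    apply: le_trans (ler_normB _ _) _.
    by rewrite mulr_natl mulr2n; apply: lerD.
  (* Recentring at D x bounds the function by the oscillation instead of the supremum of D before
     [contract] is applied. *)
  have bDc : bm (fun z => D z - D x) by apply: bmB => //; exact: bm_cst.
  have := @contract _ o bDc (fun z => Do z x) x y.
  rewrite iterB//; last exact: bm_cst.
  by rewrite iter_cst opprB addrA subrK.
(* The inequality o <= 2 m e + r o can be solved because D is bounded and o is therefore finite. *)
pose S := [set `|D z.1 - D z.2| | z in [set: E * E]].
have [_ [A DA]] := bD.
have supS : has_sup S.
  split; first by exists `|D point - D point|, (point, point).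
  exists (A + A) => _ [z _ <-]; apply: le_trans (ler_normB _ _) _; exact: lerD.
have Do x y : `|D x - D y| <= sup S by apply: sup_upper_bound => //; exists (x, y).
have : sup S <= 2 * (m%:R * e) + r * sup S.
  by apply: ge_sup; [exact: supS.1|move=> _ [z _ <-]; exact: step].
move=> h x y; apply: le_trans (Do x y) _.
by rewrite /cgeom !mulrA mulrAC ler_pdivlMr ?subr_gt0//; lra.
Qed.

End ergodic_kernel.

(** * Riemann sums *)

Section riemann_sums.
Context (R : realType).
Local Notation mu := (@lebesgue_measure R).
Variables (phi : R -> R) (C : R).
Hypothesis phiL : forall u v, `|phi u - phi v| <= C * `|u - v|.

Definition grid (n k : nat) : R := k%:R / n%:R.

Lemma gridB n k : (0 < n)%N -> grid n k.+1 - grid n k = n%:R^-1.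
Proof. by move=> n0; rewrite /grid -mulrBl -natr1 addrAC subrr add0r mul1r. Qed.

Lemma lip_ge0 : 0 <= C.
Proof. by have := le_trans (normr_ge0 _) (phiL 1 0); rewrite subr0 normr1 mulr1. Qed.

Lemma lip_continuous : continuous (phi : R -> R^o).
Proof.
have C0 := lip_ge0.
move=> x; apply/cvgrPdist_le => e e0; near=> y.
apply: le_trans (phiL x y) _.
apply: (@le_trans _ _ ((C + 1) * `|x - y|)).
  by apply: ler_wpM2r => //; rewrite lerDl.
rewrite mulrC -ler_pdivlMr ?ltr_wpDl//.
near: y; apply: cvgr_dist_le; first exact: cvg_id.
by rewrite divr_gt0// ltr_wpDl.
Unshelve. all: by end_near. Qed.

Lemma lip_integrable (a b : R) : mu.-integrable `[a, b] (EFin \o phi).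
Proof.
apply: continuous_compact_integrable; first exact: segment_compact.
by apply: continuous_subspaceT; exact: lip_continuous.
Qed.

Lemma riemann_step (x y : R) : x <= y ->
  `|(y - x) * phi y - \int[mu]_(u in `]x, y]) phi u| <= C * (y - x) ^+ 2.
Proof.
move=> xy.
have fin : fine (mu `]x, y]) = y - x.
  rewrite lebesgue_measure_itv/= lte_fin; case: ltP => // yx.
  by have -> : x = y; [apply/le_anti; rewrite xy|rewrite subrr].
have fmu : (mu `]x, y] < +oo)%E.
  by rewrite lebesgue_measure_itv/= lte_fin; case: ifP => //= _; rewrite ltry.
have ic (c : R) : mu.-integrable `]x, y] (EFin \o (fun=> c)).
  apply: measurable_bounded_integrable => //; exact: bounded_cst.
have ip : mu.-integrable `]x, y] (EFin \o phi).
  by apply: integrableS (lip_integrable x y) => //; exact: subset_itv_oc_cc.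
have -> : (y - x) * phi y = \int[mu]_(u in `]x, y]) phi y.
  by rewrite Rintegral_cst// fin mulrC.
rewrite -RintegralB//.
have id : mu.-integrable `]x, y] (EFin \o (fun u => phi y - phi u)).
  by rewrite (_ : EFin \o _ = (EFin \o (fun=> phi y)) \- (EFin \o phi))%E//; exact: integrableB.
apply: le_trans (le_normr_Rintegral _ id) _ => //.
have -> : C * (y - x) ^+ 2 = \int[mu]_(u in `]x, y]) (C * (y - x)).
  by rewrite Rintegral_cst// fin; ring.
apply: le_Rintegral => //.
  exact: (integrable_norm id).
move=> u; rewrite /= in_itv/= => /andP[xu uy].
apply: le_trans (phiL _ _) _; apply: ler_wpM2l; first exact: lip_ge0.
by rewrite ger0_norm ?subr_ge0// lerB// ltW.
Qed.

(** Each of the n cells has length 1/n and contributes an error of at most C / n^2; multiplying by n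
    leaves C. *)
Lemma riemann_sum n : (0 < n)%N ->
  `|\sum_(k < n) phi (grid n k.+1) - n%:R * \int[mu]_(u in `[0, 1]) phi u| <= C.
Proof.
move=> n0; have n0' : 0 < n%:R :> R by rewrite ltr0n.
have qmono k : grid n k <= grid n k.+1 by rewrite -subr_ge0 gridB// invr_ge0.
have q0 k : 0 <= grid n k by rewrite divr_ge0.
have key k : `|n%:R^-1 * \sum_(i < k) phi (grid n i.+1) - \int[mu]_(u in `[0, grid n k]) phi u|
    <= k%:R * (C * n%:R^-1 ^+ 2).
  elim: k => [|k ih].
    by rewrite big_ord0 mulr0 /grid mul0r set_itv1 Rintegral_set1 subrr normr0 mul0r.
  have spl : \int[mu]_(u in `[0, grid n k.+1]) phi u =
      \int[mu]_(u in `[0, grid n k]) phi u + \int[mu]_(u in `]grid n k, grid n k.+1]) phi u.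
    rewrite -(@Rintegral_itvB _ phi (BLeft 0) (BRight (grid n k.+1)) (grid n k)).
    - by rewrite addrC subrK.
    - exact: lip_integrable.
    - by rewrite bnd_simp.
    - by rewrite bnd_simp.
  have := riemann_step (qmono k); rewrite gridB// => st.
  rewrite big_ord_recr/= spl -natr1 mulrDl mul1r.
  set A := _^-1 * (_ + _); set I1 := Rintegral _ _ _; set I2 := Rintegral _ _ _.
  have -> : A - (I1 + I2) = (n%:R^-1 * (\sum_(i < k) phi (grid n i.+1)) - I1) +
     (n%:R^-1 * phi (grid n k.+1) - I2) by rewrite /A; ring.
  by apply: le_trans (ler_normD _ _) _; exact: lerD.
have qn : grid n n = 1 by rewrite /grid divff ?gt_eqF.
have := key n; rewrite qn => kn.
have -> : \sum_(k < n) phi (grid n k.+1) - n%:R * \int[mu]_(u in `[0, 1]) phi u =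
  n%:R * (n%:R^-1 * (\sum_(k < n) phi (grid n k.+1)) - \int[mu]_(u in `[0, 1]) phi u).
  by rewrite mulrBr mulrA divff ?gt_eqF// mul1r.
rewrite normrM (ger0_norm (ltW n0')) -ler_pdivlMl//; apply: le_trans kn _.
have -> // : n%:R * (C * n%:R^-1 ^+ 2) = n%:R^-1 * C.
by field; rewrite gt_eqF.
Qed.

End riemann_sums.

Arguments grid {R} n k.

(** * Martingale approximation *)

Lemma ler_eq (R : realType) (a b : R) : a = b -> a <= b.
Proof. by move=> ->. Qed.

Ltac nonneg := repeat first [assumption | exact: ler0n | exact: ler01 | exact: normr_ge0 |
  apply: addr_ge0 | apply: mulr_ge0 | apply: exprn_ge0].

Section kernel_family.
Context d (E : measurableType d) (R : realType).
Variables (Q : R -> R.-pker E ~> E) (pi : R -> probability E R).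
Variables (L r : R) (m : nat).
Hypotheses (Qpi : forall u, invariant (Q u) (pi u)).
Hypotheses (L0 : 0 <= L) (m0 : (0 < m)%N) (r0 : 0 <= r) (r1 : r < 1).
Hypothesis contract : forall u f (M : R), bm f -> (forall x, `|f x| <= M) ->
  forall x y, `|iter m (kact (Q u)) f x - iter m (kact (Q u)) f y| <= r * M.
Hypothesis lipQ : forall u v f (M : R), bm f -> (forall x, `|f x| <= M) ->
  forall x, `|kact (Q u) f x - kact (Q v) f x| <= L * `|u - v| * M.

(** A single constant bounds both the values and the Lipschitz modulus in u, so every closure
    property has one number to propagate. *)
Definition lipfam (C : R) (G : R -> E -> R) :=
  [/\ forall u, bm (G u), forall u x, `|G u x| <= C &
      forall u v x, `|G u x - G v x| <= C * `|u - v|].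

Local Notation c0 := (cgeom m r).

Lemma lipfam_ge0 C G : lipfam C G -> 0 <= C.
Proof. by move=> [_ GC _]; apply: le_trans (GC 0 point). Qed.

Lemma lipfamB C C' G G' : lipfam C G -> lipfam C' G' ->
  lipfam (C + C') (fun u x => G u x - G' u x).
Proof.
move=> [bG GC GL] [bG' GC' GL']; split.
- by move=> u; exact: bmB.
- by move=> u x; apply: le_trans (ler_normB _ _) _; exact: lerD.
- move=> u v x; rewrite mulrDl.
  have -> : G u x - G' u x - (G v x - G' v x) =
    (G u x - G v x) - (G' u x - G' v x) by ring.
  by apply: le_trans (ler_normB _ _) _; exact: lerD.
Qed.

Lemma lipfam_sqr C G : lipfam C G -> lipfam (C ^+ 2 + C * C) (fun u x => G u x ^+ 2).
Proof.
move=> [bG GC GL]; have C0 : 0 <= C by exact: lipfam_ge0.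
split.
- by move=> u; exact: bmX.
- move=> u x; rewrite normrX; apply: le_trans (_ : C ^+ 2 <= _).
    by rewrite lerXn2r// nnegrE.
  by rewrite lerDl mulr_ge0.
- move=> u v x; rewrite subr_sqr normrM.
  have -> : (C ^+ 2 + C * C) * `|u - v| = C * `|u - v| * (C + C) by ring.
  apply: ler_pM => //; apply: le_trans (ler_normD _ _) _; exact: lerD.
Qed.

Lemma lipfam_kact C G : lipfam C G -> lipfam (C + L * C) (fun u => kact (Q u) (G u)).
Proof.
move=> [bG GC GL]; have C0 : 0 <= C by exact: lipfam_ge0.
split.
- by move=> u; exact: bm_pkact.
- move=> u x; apply: (@le_trans _ _ C); first exact: int_bound.
  by rewrite lerDl mulr_ge0.
- move=> u v x.
  have -> : kact (Q u) (G u) x - kact (Q v) (G v) x =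
    (kact (Q u) (G u) x - kact (Q u) (G v) x) +
    (kact (Q u) (G v) x - kact (Q v) (G v) x) by ring.
  rewrite mulrDl; apply: le_trans (ler_normD _ _) _; apply: lerD.
    by apply: int_dist.
  rewrite mulrAC; exact: lipQ.
Qed.

(* With [h] the Poisson solution of [f] for [Q u], invariance of [pi v] turns the
   difference of the means into [pi v (Q u h - Q v h)]. *)
Lemma pi_lip u v f (M : R) : bm f -> (forall x, `|f x| <= M) ->
  `|\int[pi u]_x f x - \int[pi v]_x f x| <= 2 * L * c0 * M * `|u - v|.
Proof.
move=> bf fM; set b := \int[pi u]_x f x.
have bM : `|b| <= M by exact: int_bound.
pose F x := f x - b.
have bF : bm F by apply: bmB => //; exact: bm_cst.
have FM x : `|F x| <= M + M.
  by apply: le_trans (ler_normB _ _) _; exact: lerD.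
have F0 : \int[pi u]_x F x = 0.
  by rewrite intB// ?int_cst ?subrr//; exact: bm_cst.
have C := contract u.
have bh := bm_poisson (Qpi u) m0 r0 r1 C bF FM F0.
have hM := poisson_bound (Qpi u) m0 r0 r1 C bF FM F0.
set h := poisson (Q u) F in bh hM.
have bT w : bm (kact (Q w) h) by exact: bm_pkact.
have -> : b - \int[pi v]_x f x = \int[pi v]_x (kact (Q u) h x - kact (Q v) h x).
  transitivity (- \int[pi v]_x F x).
    by rewrite intB// ?int_cst ?opprB//; exact: bm_cst.
  have -> : \int[pi v]_x F x = \int[pi v]_x (h x - kact (Q u) h x).
    by apply: eq_Rintegral => x _; rewrite (poisson_eq (Qpi u) m0 r0 r1 C bF FM F0).
  by rewrite !intB// (invariant_int (Qpi v))// opprB.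
apply: int_bound => //; first exact: bmB.
move=> x; apply: le_trans (lipQ _ _ bh hM x) _.
by apply: ler_eq; ring.
Qed.

Lemma pi_bound C G u : lipfam C G -> `|\int[pi u]_x G u x| <= C.
Proof. by move=> [bG GC GL]; exact: int_bound. Qed.

Lemma pi_fam_lip C G u v : lipfam C G ->
  `|\int[pi u]_x G u x - \int[pi v]_x G v x| <= (C + 2 * L * c0 * C) * `|u - v|.
Proof.
move=> [bG GC GL].
have -> : \int[pi u]_x G u x - \int[pi v]_x G v x =
   (\int[pi u]_x G u x - \int[pi u]_x G v x) +
   (\int[pi u]_x G v x - \int[pi v]_x G v x) by ring.
rewrite mulrDl; apply: le_trans (ler_normD _ _) _; apply: lerD.
  exact: int_dist.
exact: pi_lip.
Qed.

Lemma lipfam_cent C G : lipfam C G ->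
  lipfam (C + (C + 2 * L * c0 * C)) (gcent pi G).
Proof.
move=> lG; have C0 := lipfam_ge0 lG; apply: lipfamB => //; split.
- by move=> u; exact: bm_cst.
- move=> u x; apply: le_trans (pi_bound u lG) _.
  have c00 : 0 <= c0 by exact: cgeom_ge0.
  by rewrite lerDl; nonneg.
- by move=> u v _; exact: pi_fam_lip.
Qed.

Lemma int_cent C G u : lipfam C G -> \int[pi u]_x gcent pi G u x = 0.
Proof. by move=> [bG _ _]; rewrite intB// ?int_cst ?subrr//; exact: bm_cst. Qed.

(** The difference D = h_u - h_v satisfies D - Q_u D = (G_u - G_v) - (Q_v h_v - Q_u h_v), which is
    of order |u - v|; [osc_bound] then controls D up to a constant. That constant is the mean of D
    under pi_u, equal to pi_v(h_v) - pi_u(h_v) because both solutions are centred, and [pi_lip]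
    bounds it. *)
Lemma lipfam_poisson C G : lipfam C G -> (forall u, \int[pi u]_x G u x = 0) ->
  exists C', lipfam C' (fun u => poisson (Q u) (G u)).
Proof.
move=> lG G0; have C0 := lipfam_ge0 lG; have [bG GC GL] := lG.
pose h u := poisson (Q u) (G u).
have bh u : bm (h u) by exact: (bm_poisson (Qpi u) m0 r0 r1 (@contract u) (bG u) (GC u)).
have hM u x : `|h u x| <= c0 * C.
  exact: (poisson_bound (Qpi u) m0 r0 r1 (@contract u) (bG u) (GC u)).
have heq u x : h u x - kact (Q u) (h u) x = G u x.
  exact: (poisson_eq (Qpi u) m0 r0 r1 (@contract u) (bG u) (GC u)).
have ih u : \int[pi u]_x h u x = 0.
  exact: (int_poisson (Qpi u) m0 r0 r1 (@contract u) (bG u) (GC u)).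
suff : exists C', lipfam C' h by [].
clearbody h.
have c00 : 0 <= c0 by exact: cgeom_ge0.
pose e := C + L * (c0 * C).
have e0 : 0 <= e by rewrite /e; nonneg.
(* The summands bound, in order, the supremum of h, the oscillation of D and its mean. *)
exists (c0 * C + (2 * c0 * e + 2 * L * c0 * (c0 * C))); split.
- exact: bh.
- by move=> u x; apply: le_trans (hM u x) _; rewrite lerDl; nonneg.
move=> u v x.
pose D x := h u x - h v x.
have bD : bm D by apply: bmB; exact: bh.
have bT w w' : bm (kact (Q w) (h w')) by apply: bm_pkact; exact: bh.
have De y : `|D y - kact (Q u) D y| <= e * `|u - v|.
  rewrite kactB//; [|exact: bh..].
  have -> : D y - (kact (Q u) (h u) y - kact (Q u) (h v) y) =
    (G u y - G v y) - (kact (Q v) (h v) y - kact (Q u) (h v) y).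
    by rewrite -(heq u) -(heq v) /D; ring.
  rewrite /e mulrDl; apply: le_trans (ler_normB _ _) _; apply: lerD => //.
  apply: le_trans (lipQ _ _ (bh v) (hM v) y) _.
  by rewrite distrC mulrAC.
have osc := osc_bound r1 (@contract u) bD De.
have a1 := dist_int_le (pi u) bD (osc x).
have iD : \int[pi u]_y D y = \int[pi v]_y h v y - \int[pi u]_y h v y.
  by rewrite intB//; [rewrite !ih|exact: bh..].
have a2 := pi_lip v u (bh v) (hM v).
rewrite -/(D x) -(subrK (\int[pi u]_y D y) (D x)).
apply: le_trans (ler_normD _ _) _.
rewrite mulrDl mulrDl; apply: ler_wpDl; first by nonneg.
apply: lerD; first by move: a1; rewrite mulrA.
by rewrite iD distrC (distrC u v) distrC.
Qed.

Lemma dist_grid n k : (0 < n)%N -> `|grid n k.+1 - grid n k| = n%:R^-1 :> R.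
Proof. by move=> n0; rewrite gridB// ger0_norm. Qed.

Section row.
Context (dO : measure_display) (Omega : measurableType dO) (P : probability Omega R).
Variables (X : nat -> {RV P >-> E}) (n : nat).
Hypotheses (n0 : (0 < n)%N).
Local Notation Ex Z := (\int[P]_w (Z : Omega -> R) w).
Implicit Types Z : Omega -> R.

Definition drift (W : R -> E -> R) k w : R := W (grid n k.+1) (X k w) - W (grid n k.+1) (X k.+1 w).

Lemma drift_eq W w : \sum_(k < n) drift W k w =
  W (grid n 0) (X 0 w) - W (grid n n) (X n w) +
  \sum_(k < n) (W (grid n k.+1) (X k w) - W (grid n k) (X k w)).
Proof.
have key j : \sum_(k < j) drift W k w =
  W (grid n 0) (X 0 w) - W (grid n j) (X j w) +
  \sum_(k < j) (W (grid n k.+1) (X k w) - W (grid n k) (X k w)).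
  elim: j => [|j ih]; first by rewrite !big_ord0 subrr addr0.
  by rewrite !big_ord_recr/= ih /drift; ring.
exact: key.
Qed.

Lemma drift_bound C W w : lipfam C W -> `|\sum_(k < n) drift W k w| <= 3 * C.
Proof.
move=> [_ WC WL]; rewrite drift_eq.
(* Two boundary terms, and n increments in the parameter of at most C / n each. *)
have -> : 3 * C = C + C + C by ring.
apply: le_trans (ler_normD _ _) (lerD _ _).
  by apply: le_trans (ler_normB _ _) _; exact: lerD.
apply: le_trans (ler_norm_sum _ _ _) _.
have -> : C = \sum_(k < n) (C * n%:R^-1).
  by rewrite sumr_const card_ord -[RHS]mulr_natr divfK// pnatr_eq0 -lt0n.
by apply: ler_sum => k _; rewrite -(dist_grid k n0); exact: WL.
Qed.

Hypothesis row : forall k, (k < n)%N -> markov_step X k (Q (grid n k.+1)).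

(* The consequence of being measurable with respect to [X 0, ..., X k] that the
   argument needs; it is stable under linear combinations. *)
Definition past k Z := bm Z /\ forall j f, (k <= j < n)%N -> bm f ->
  Ex (fun w => Z w * f (X j.+1 w)) =
  Ex (fun w => Z w * kact (Q (grid n j.+1)) f (X j w)).

Lemma past_bm k Z : past k Z -> bm Z. Proof. by case. Qed.

Lemma past_coord i k p : (i <= k)%N -> bm p -> past k (fun w => p (X i w)).
Proof.
move=> ik bp; split; first exact: bm_RV.
move=> j f /andP[kj jn] bf; apply: (markov_step_int (row jn)) => //.
exact: leq_trans ik kj.
Qed.

Lemma pastB k Z Z' : past k Z -> past k Z' -> past k (fun w => Z w - Z' w).
Proof.
move=> [bZ h] [bZ' h']; split; first exact: bmB.
move=> j f kj bf.
have bX i (f' : E -> R) : bm f' -> bm (fun w => f' (X i w)) by exact: bm_RV.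
have bK : bm (kact (Q (grid n j.+1)) f) by exact: bm_pkact.
transitivity (Ex (fun w => Z w * f (X j.+1 w) - Z' w * f (X j.+1 w))).
  by apply: eq_Rintegral => w _; rewrite mulrBl.
rewrite intB//; [|by apply: bmM => //; exact: bX..].
rewrite h// h'// -intB//; [|by apply: bmM => //; exact: bX..].
by apply: eq_Rintegral => w _; rewrite mulrBl.
Qed.

Lemma past_sum k N (F : nat -> Omega -> R) : (forall i, (i < N)%N -> past k (F i)) ->
  past k (fun w => \sum_(i < N) F i w).
Proof.
elim: N => [|N ih] h.
  under eq_fun do rewrite big_ord0.
  split; first exact: bm_cst.
  by move=> j f _ _; rewrite !int_eq0// => w; rewrite mul0r.
(* Addition is obtained from [pastB] by subtracting a negative, with zero spelled [0 * 0 - 0]. *)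
have -> : (fun w => \sum_(i < N.+1) F i w) =
    (fun w => \sum_(i < N) F i w - ((0 * 0 - 0) - F N w)).
  by apply/funext => w; rewrite big_ord_recr/=; ring.
apply: pastB; first by apply: ih => i iN; apply: h; rewrite ltnS ltnW.
apply: pastB; last exact: h.
split; first exact: bm_cst.
by move=> j f _ _; rewrite !int_eq0// => w; rewrite mul0r subr0 mul0r.
Qed.

Section martingale.
Variables (H : R -> E -> R) (C : R).
Hypothesis lH : lipfam C H.

Let W u := kact (Q u) (H u).
Let bX i (f : E -> R) : bm f -> bm (fun w => f (X i w)). Proof. exact: bm_RV. Qed.
Let bH u : bm (H u). Proof. by case: lH. Qed.
Let bW u : bm (W u). Proof. exact: bm_pkact. Qed.
Let C0 : 0 <= C. Proof. exact: lipfam_ge0 lH. Qed.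

Definition mdiff k w : R :=
  H (grid n k.+1) (X k.+1 w) - kact (Q (grid n k.+1)) (H (grid n k.+1)) (X k w).

Definition mart k w : R := \sum_(i < k) mdiff i w.

Lemma past_mdiff i k : (i < k)%N -> past k (mdiff i).
Proof.
move=> ik; apply: pastB; first exact: (past_coord ik (bH _)).
exact: (past_coord (ltnW ik) (bW _)).
Qed.

Lemma past_mart k : past k (mart k).
Proof. by apply: past_sum => i; exact: past_mdiff. Qed.

Let bD k : bm (mdiff k). Proof. exact: past_bm (past_mdiff (ltnSn k)). Qed.
Let bM k : bm (mart k). Proof. exact: past_bm (past_mart k). Qed.

Lemma mdiff_bound k w : `|mdiff k w| <= 2 * C.
Proof.
have [_ HC _] := lH.
have -> : 2 * C = C + C by ring.
apply: le_trans (ler_normB _ _) _; apply: lerD => //.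
exact: kact_bound.
Qed.

Lemma mart_bound k w : `|mart k w| <= 2 * C * k%:R.
Proof.
apply: le_trans (ler_norm_sum _ _ _) _.
have -> : 2 * C * k%:R = \sum_(i < k) (2 * C).
  by rewrite sumr_const card_ord mulr_natr.
by apply: ler_sum => i _; exact: mdiff_bound.
Qed.

Lemma past_mdiff_orth k j Z : past k Z -> (k <= j < n)%N ->
  Ex (fun w => Z w * mdiff j w) = 0.
Proof.
move=> pZ kj; have [bZ h] := pZ.
transitivity (Ex (fun w => Z w * H (grid n j.+1) (X j.+1 w)
                   - Z w * W (grid n j.+1) (X j w))).
  by apply: eq_Rintegral => w _; rewrite mulrBr.
rewrite intB//; [|by apply: bmM => //; exact: bX..].
by rewrite h// subrr.
Qed.

(** The martingale property in tested form: increments after time k are orthogonal to the past of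
    k. *)
Lemma past_mart_stop k N Z : past k Z -> (k <= N <= n)%N ->
  Ex (fun w => Z w * mart N w) = Ex (fun w => Z w * mart k w).
Proof.
move=> pZ; have [bZ h] := pZ; elim: N => [|N ih] /andP[].
  by rewrite leqn0 => /eqP ->.
rewrite leq_eqVlt => /orP[/eqP->//|]; rewrite ltnS => kN Nn.
rewrite -ih ?kN 1?ltnW//.
transitivity (Ex (fun w => Z w * mart N w + Z w * mdiff N w)).
  by apply: eq_Rintegral => w _; rewrite /mart big_ord_recr/= mulrDr.
rewrite intD//; [|exact: bmM..].
by rewrite (past_mdiff_orth pZ) ?kN ?addr0.
Qed.

Lemma past_cst c : past 0 (fun=> c).
Proof. by apply: (@past_coord 0 0 (fun=> c)) => //; exact: bm_cst. Qed.

Lemma int_mart k : (k <= n)%N -> Ex (mart k) = 0.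
Proof.
move=> kn; transitivity (Ex (fun w => 1 * mart k w)).
  by apply: eq_Rintegral => w _; rewrite mul1r.
rewrite (@past_mart_stop 0 k _ (past_cst 1)) ?kn//.
by rewrite int_eq0// => w; rewrite /mart big_ord0 mulr0.
Qed.

Lemma int_mart_sqr k : (k <= n)%N ->
  Ex (fun w => mart k w ^+ 2) = \sum_(i < k) Ex (fun w => mdiff i w ^+ 2).
Proof.
elim: k => [|k ih] kn.
  by rewrite big_ord0 int_eq0// => w; rewrite /mart big_ord0 expr0n.
rewrite big_ord_recr/= -ih; last exact: ltnW.
transitivity (Ex (fun w => mart k w ^+ 2 + mdiff k w ^+ 2 + 2 * (mart k w * mdiff k w))).
  by apply: eq_Rintegral => w _; rewrite /mart big_ord_recr/=; ring.
rewrite intD//; first last.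
- by apply: bmM; [exact: bm_cst|exact: bmM].
- by apply: bmD; exact: bmX.
rewrite intZ//; last exact: bmM.
by rewrite (past_mdiff_orth (past_mart k)) ?leqnn// mulr0 addr0 intD//; exact: bmX.
Qed.

(** Pythagoras: H(X_(k+1)) is the sum of W(X_k), which belongs to the past of k, and of [mdiff k],
    which is orthogonal to it. *)
Lemma int_mdiff_sqr k : (k < n)%N ->
  Ex (fun w => mdiff k w ^+ 2) = Ex (fun w => H (grid n k.+1) (X k.+1 w) ^+ 2) -
    Ex (fun w => W (grid n k.+1) (X k w) ^+ 2).
Proof.
move=> kn.
have pW : past k (fun w => W (grid n k.+1) (X k w)) by exact: past_coord.
have bWX : bm (fun w => W (grid n k.+1) (X k w)) by exact: bX.
have bHX : bm (fun w => H (grid n k.+1) (X k.+1 w)) by exact: bX.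
transitivity (Ex (fun w => (H (grid n k.+1) (X k.+1 w) ^+ 2 -
   W (grid n k.+1) (X k w) ^+ 2) - 2 * (W (grid n k.+1) (X k w) * mdiff k w))).
  by apply: eq_Rintegral => w _; rewrite /mdiff -/(W _); ring.
rewrite intB//; first last.
- by apply: bmM; [exact: bm_cst|exact: bmM].
- by apply: bmB; exact: bmX.
rewrite intZ//; last exact: bmM.
by rewrite (past_mdiff_orth pW) ?leqnn// mulr0 subr0 intB//; exact: bmX.
Qed.

(* [transport k i p] is [Q_(k+1) ... Q_(k+i) p]. *)
Fixpoint transport k i p : E -> R :=
  if i is i'.+1 then transport k i' (kact (Q (grid n (k + i').+1)) p) else p.

Lemma bm_transport k i p : bm p -> bm (transport k i p).
Proof. by elim: i p => //= i ih p bp; apply: ih; exact: bm_pkact. Qed.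

Lemma past_transport k i p Z : past k Z -> (k + i <= n)%N -> bm p ->
  Ex (fun w => Z w * p (X (k + i) w)) = Ex (fun w => Z w * transport k i p (X k w)).
Proof.
move=> pZ; elim: i p => [|i ih] p kin bp; first by rewrite addn0.
have [bZ h] := pZ; rewrite addnS h//; last first.
  by rewrite leq_addr/= -addnS.
by rewrite ih//; [rewrite ltnW// -addnS|exact: bm_pkact].
Qed.

(** The kernels are frozen at time k one at a time, starting with the one next to p. Each
    replacement moves the parameter by at most m / n, and the other kernels do not increase the
    supremum norm. *)
Lemma transport_iter k i p A : (i <= m)%N -> bm p -> (forall x, `|p x| <= A) ->
  forall x, `|transport k i p x - iter i (kact (Q (grid n k))) p x| <=
    i%:R * (m%:R * L / n%:R * A).
Proof.
elim: i p => [|i ih] p im bp pA x; first by rewrite subrr normr0 mul0r.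
have A0 : 0 <= A by apply: le_trans (pA point).
rewrite iterSr/=; set p' := kact (Q (grid n (k + i).+1)) p.
have bp' : bm p' by exact: bm_pkact.
have bp'' : bm (kact (Q (grid n k)) p) by exact: bm_pkact.
have -> : transport k i p' x - iter i (kact (Q (grid n k))) (kact (Q (grid n k)) p) x =
   (transport k i p' x - iter i (kact (Q (grid n k))) p' x) +
   (iter i (kact (Q (grid n k))) p' x - iter i (kact (Q (grid n k))) (kact (Q (grid n k)) p) x)
  by ring.
apply: le_trans (ler_normD _ _) _; rewrite -natr1 mulrDl mul1r; apply: lerD.
  by apply: ih => //; [exact: ltnW|exact: kact_bound].
have := @iterB _ _ _ (Q (grid n k)) i _ _ bp' bp''.
move=> /(congr1 (fun f => f x))/= <-.
apply: iter_bound; first exact: bmB.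
move=> y; apply: le_trans (lipQ _ _ bp pA y) _.
apply: ler_wpM2r => //.
have -> : `|grid n (k + i).+1 - grid n k| = i.+1%:R / n%:R :> R.
  by rewrite /grid -addnS natrD -mulrBl addrAC subrr add0r ger0_norm// divr_ge0.
rewrite mulrA; apply: ler_wpM2r; first by rewrite invr_ge0.
by rewrite mulrC; apply: ler_wpM2r => //; rewrite ler_nat.
Qed.

(** The increments are at most 2 C. The first summand covers rows with n <= N0; the second gives 4 C
    m / (1 - r), the fixed point of x = (1 + r) / 2 x + 2 C m, which is the recursion over one block
    of m steps. *)
Definition decorr (N0 : nat) : R := 2 * C * (N0%:R + 2 * m%:R / (1 - r)).

(* Induction in steps of [m]: over [m] steps the oscillation of the transported
   [p] shrinks by [(1 + r) / 2] once [n] exceeds [N0], constants are killed since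
   the martingale is centred, and the last [m] differences are bounded; for
   [n <= N0] the martingale itself is bounded. *)
Lemma mart_decorr (N0 k : nat) p A :
  4 * m%:R ^+ 2 * L <= (1 - r) * N0%:R -> (k <= n)%N ->
  bm p -> (forall x, `|p x| <= A) ->
  `|Ex (fun w => mart k w * p (X k w))| <= decorr N0 * A.
Proof.
move=> hN0 + bp pA.
have r1' : 0 < 1 - r by rewrite subr_gt0.
have mr : m%:R <= 2 * m%:R / (1 - r) :> R.
  rewrite ler_pdivlMr//; have : 0 <= m%:R * (1 + r) by rewrite mulr_ge0// addr_ge0.
  by move=> h; lra.
have triv j p' A' : bm p' -> (forall x, `|p' x| <= A') -> (j <= N0)%N || (j <= m)%N ->
    `|Ex (fun w => mart j w * p' (X j w))| <= decorr N0 * A'.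
  move=> bp' pA' jN; apply: int_bound => //; first by apply: bmM => //; exact: bX.
  move=> w; rewrite normrM; apply: ler_pM => //.
  apply: le_trans (mart_bound j w) _.
  apply: ler_wpM2l; first by rewrite mulr_ge0.
  case/orP: jN => jN.
    by apply: ler_wpDr; rewrite ?ler_nat// divr_ge0// ?mulr_ge0// ltW.
  by apply: ler_wpDl => //; apply: le_trans mr; rewrite ler_nat.
have [nN0 kn|N0n] := leqP n N0.
  by apply: triv => //; rewrite (leq_trans kn nN0).
have A0 : 0 <= A by apply: le_trans (pA point).
have dec0 : 0 <= decorr N0.
  by rewrite !mulr_ge0// addr_ge0// divr_ge0// ?mulr_ge0// ltW.
elim/ltn_ind: k p A bp pA A0 => k ih p A bp pA A0 kn.
have [km|mk] := leqP k m; first by apply: triv => //; rewrite km orbT.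
pose k' := (k - m)%N.
have kE : k = (k' + m)%N by rewrite subnK// ltnW.
have k'k : (k' < k)%N by rewrite kE -[X in (X < _)%N]addn0 ltn_add2l.
have k'n : (k' <= n)%N by rewrite (leq_trans _ kn)// ltnW.
pose p1 := transport k' m p.
have bp1 : bm p1 by exact: bm_transport.
pose p2 x := p1 x - p1 point.
have bp2 : bm p2 by apply: bmB => //; exact: bm_cst.
have n0' : 0 < n%:R :> R by rewrite ltr0n.
have p2A x : `|p2 x| <= (1 + r) / 2 * A.
  have tr := transport_iter k' (leqnn m) bp pA.
  have ct := contract (grid n k') bp pA x point.
  have -> : p2 x = (p1 x - iter m (kact (Q (grid n k'))) p x)
     - (p1 point - iter m (kact (Q (grid n k'))) p point)
     + (iter m (kact (Q (grid n k'))) p x - iter m (kact (Q (grid n k'))) p point).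
    by rewrite /p2; ring.
  apply: le_trans (ler_normD _ _) _.
  apply: le_trans (lerD (le_trans (ler_normB _ _) (lerD (tr x) (tr point))) ct) _.
  (* The freezing error enters at x and at the base point. A quarter of 1 - r for each gives the
     factor r + (1 - r) / 2 = (1 + r) / 2, and this is the source of the 4 in the condition on
     N0. *)
  have h : m%:R * (m%:R * L / n%:R) <= (1 - r) / 4.
    rewrite ler_pdivlMr// mulrA mulrA mulrAC ler_pdivrMr//.
    have : (1 - r) * N0%:R <= (1 - r) * n%:R.
      by apply: ler_wpM2l; [exact: ltW|rewrite ler_nat ltnW].
    by move: hN0; rewrite expr2; lra.
  have := ler_wpM2r A0 h; rewrite -[_ * _ * A]mulrA => h'; lra.
have e1 : Ex (fun w => mart k' w * p (X k w)) = Ex (fun w => mart k' w * p2 (X k' w)).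
  rewrite [in LHS]kE (past_transport (past_mart k'))//; last by rewrite -kE.
  transitivity (Ex (fun w => mart k' w * p2 (X k' w) + p1 point * mart k' w)).
    by apply: eq_Rintegral => w _; rewrite /p2 -/p1; ring.
  rewrite intD//; first last.
  - by apply: bmM; [exact: bm_cst|].
  - by apply: bmM => //; exact: bX.
  by rewrite intZ// int_mart// mulr0 addr0.
have e2 : Ex (fun w => mart k w * p (X k w)) = Ex (fun w => mart k' w * p (X k w)) +
    Ex (fun w => (mart k w - mart k' w) * p (X k w)).
  rewrite -intD//; first by apply: eq_Rintegral => w _; ring.
  - by apply: bmM => //; exact: bX.
  - by apply: bmM; [exact: bmB|exact: bX].
rewrite e2 e1; apply: le_trans (ler_normD _ _) _.
have h2A : 0 <= (1 + r) / 2 * A by rewrite mulr_ge0// divr_ge0// addr_ge0.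
apply: (@le_trans _ _ (decorr N0 * ((1 + r) / 2 * A) + 2 * C * m%:R * A)).
  apply: lerD; first exact: ih.
  apply: int_bound => //; first by apply: bmM; [exact: bmB|exact: bX].
  move=> w; rewrite normrM; apply: ler_pM => //.
  rewrite /mart kE big_split_ord/= addrAC subrr add0r.
  apply: le_trans (ler_norm_sum _ _ _) _.
  have -> : 2 * C * m%:R = \sum_(i < m) (2 * C).
    by rewrite sumr_const card_ord mulr_natr.
  by apply: ler_sum => i _; exact: mdiff_bound.
have h3 : 2 * C * m%:R <= decorr N0 * ((1 - r) / 2).
  rewrite /decorr -[leRHS]mulrA; apply: ler_wpM2l; first by nonneg.
  rewrite mulrDl; apply: ler_wpDl; first by rewrite mulr_ge0// divr_ge0// ltW.
  have -> // : 2 * m%:R / (1 - r) * ((1 - r) / 2) = m%:R.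
  by field; rewrite gt_eqF.
have := ler_wpM2r A0 h3; lra.
Qed.

(** After Abel summation every term depends on one X_k only, so the martingale can be stopped at
    time k and [mart_decorr] applies; the n increments have size C' / n and add up to one more
    boundary term. *)
Lemma past_drift_cov (N0 : nat) C' V :
  4 * m%:R ^+ 2 * L <= (1 - r) * N0%:R -> lipfam C' V ->
  `|Ex (fun w => mart n w * \sum_(k < n) drift V k w)| <= decorr N0 * (3 * C').
Proof.
move=> hN0 lV; have [bV VC VL] := lV.
have bVX u i : bm (fun w => V u (X i w)) by exact: bX.
have stop p k A : bm p -> (forall x, `|p x| <= A) -> (k <= n)%N ->
    `|Ex (fun w => mart n w * p (X k w))| <= decorr N0 * A.
  move=> bp pA kn.
  have -> : Ex (fun w => mart n w * p (X k w)) = Ex (fun w => mart k w * p (X k w)).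
    under eq_Rintegral do rewrite mulrC.
    rewrite (past_mart_stop (past_coord (leqnn k) bp)) ?kn ?leqnn//.
    by under eq_Rintegral do rewrite mulrC.
  exact: mart_decorr.
pose dV k x := V (grid n k.+1) x - V (grid n k) x.
have bdV k : bm (dV k) by apply: bmB; exact: bV.
have bdVX k i : bm (fun w => dV k (X i w)) by exact: bX.
have -> : Ex (fun w => mart n w * \sum_(k < n) drift V k w) =
  Ex (fun w => mart n w * V (grid n 0) (X 0 w)) -
  Ex (fun w => mart n w * V (grid n n) (X n w)) +
  \sum_(k < n) Ex (fun w => mart n w * dV k (X k w)).
  rewrite -(@int_sum _ _ _ P _ n (fun k w => mart n w * dV k (X k w)))//; last first.
    by move=> i; exact: bmM.
  rewrite -intB//; [|exact: bmM..].
  rewrite -intD//; [|by apply: bmB; exact: bmM|by apply: bm_sum => i; exact: bmM].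
  by apply: eq_Rintegral => w _; rewrite drift_eq mulrDr mulrBr mulr_sumr.
have -> : decorr N0 * (3 * C') = decorr N0 * C' + decorr N0 * C' + decorr N0 * C' by ring.
apply: le_trans (ler_normD _ _) (lerD _ _).
  by apply: le_trans (ler_normB _ _) (lerD _ _); apply: stop.
apply: le_trans (ler_norm_sum _ _ _) _.
have -> : decorr N0 * C' = \sum_(k < n) (decorr N0 * (C' * n%:R^-1)).
  rewrite sumr_const card_ord -[RHS]mulr_natr -mulrA divfK//.
  by rewrite pnatr_eq0 -lt0n.
apply: ler_sum => k _; apply: stop => //; last exact: ltnW.
by move=> x; rewrite -(dist_grid k n0); exact: VL.
Qed.

End martingale.

(** * Mean and variance of row sums *)

Definition row_sum (G : R -> E -> R) w : R := \sum_(k < n) G (grid n k.+1) (X k.+1 w).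
Definition pi_sum (G : R -> E -> R) : R := \sum_(k < n) \int[pi (grid n k.+1)]_x G (grid n k.+1) x.

Lemma bm_row_sum G : (forall u, bm (G u)) -> bm (row_sum G).
Proof.
by move=> bG; apply: (@bm_sum _ _ _ _ _ _ (fun (k : 'I_n) w => G (grid n k.+1) (X k.+1 w)))
  => k; exact: bm_RV.
Qed.

Lemma bm_drift_sum G : (forall u, bm (G u)) -> bm (fun w => \sum_(k < n) drift G k w).
Proof. by move=> bG; apply: bm_sum => k; apply: bmB; exact: bm_RV. Qed.

Lemma row_sum_poisson C G w : lipfam C G -> row_sum G w - pi_sum G =
  mart (fun u => poisson (Q u) (gcent pi G u)) n w +
  \sum_(k < n) drift (fun u => kact (Q u) (poisson (Q u) (gcent pi G u))) k w.
Proof.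
move=> lG; have [bG GC _] := lipfam_cent lG.
have G0 u := int_cent u lG.
rewrite -sumrB -big_split/=; apply: eq_bigr => k _.
rewrite -[LHS]/(gcent pi G (grid n k.+1) (X k.+1 w)).
rewrite -(poisson_eq (Qpi _) m0 r0 r1 (@contract _) (bG _) (GC _) (G0 _)).
by rewrite /mdiff /drift; ring.
Qed.

End row.

(** The bound is chosen before the probability space, the chain and n, so it is uniform over rows
    that live on different spaces. *)
Lemma row_mean C G : lipfam C G -> exists B, forall (dO : measure_display)
    (Omega : measurableType dO) (P : probability Omega R) (X : nat -> {RV P >-> E}) n,
  (0 < n)%N -> (forall k, (k < n)%N -> markov_step X k (Q (grid n k.+1))) ->
  `|\int[P]_w row_sum X n G w - pi_sum n G| <= B.
Proof.
move=> lG; have lF := lipfam_cent lG.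
have [C' lH] := lipfam_poisson lF (fun u => int_cent u lG).
have lW := lipfam_kact lH.
exists (3 * (C' + L * C')) => dO Omega P X n n0 row.
have bG : forall u, bm (G u) by case: lG.
have bW := let: And3 h _ _ := lW in h.
have bM := past_bm (past_mart row lH n).
rewrite -[X in _ - X](@int_cst _ _ _ P)// -intB//; first last.
- exact: bm_cst.
- exact: bm_row_sum.
under eq_Rintegral do rewrite (row_sum_poisson _ _ _ lG).
rewrite intD//; last exact: bm_drift_sum.
rewrite (int_mart row lH (leqnn n)) add0r.
apply: int_bound => //; first exact: bm_drift_sum.
by move=> w; exact: drift_bound.
Qed.

Definition mvar (G : R -> E -> R) u x : R :=
  poisson (Q u) (gcent pi G u) x ^+ 2 -
  kact (Q u) (poisson (Q u) (gcent pi G u)) x ^+ 2.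

Lemma lipfam_mvar C G : lipfam C G -> exists C', lipfam C' (mvar G).
Proof.
move=> lG; have lF := lipfam_cent lG.
have [C' lH] := lipfam_poisson lF (fun u => int_cent u lG).
by eexists; exact: lipfamB (lipfam_sqr lH) (lipfam_sqr (lipfam_kact lH)).
Qed.

(** The centring c is left free: the mean of the row sum gives the variance, and n b gives the
    second moment about n b. The row sum minus c is M + D + e, with M the martingale, D the bounded
    drift and e a bounded constant. *)
Lemma row_variance C G B0 : lipfam C G -> exists B, forall (dO : measure_display)
    (Omega : measurableType dO) (P : probability Omega R) (X : nat -> {RV P >-> E}) n c,
  (0 < n)%N -> (forall k, (k < n)%N -> markov_step X k (Q (grid n k.+1))) ->
  `|pi_sum n G - c| <= B0 ->
  `|\int[P]_w ((row_sum X n G w - c) ^+ 2) - pi_sum n (mvar G)| <= B.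
Proof.
move=> lG; have lF := lipfam_cent lG.
have [C' lH] := lipfam_poisson lF (fun u => int_cent u lG).
have [CV lV] := lipfam_mvar lG.
have lW := lipfam_kact lH; set CW := C' + L * C' in lW.
have lW2 := lipfam_sqr lW; set CW2 := _ + _ in lW2.
have [BV hBV] := row_mean lV.
have r1' : 0 < 1 - r by rewrite subr_gt0.
(* The threshold beyond which m steps contract depends on m, L and r only, so it can be fixed before
   n. *)
have [N0 hN0] : exists N0 : nat, 4 * m%:R ^+ 2 * L <= (1 - r) * N0%:R.
  exists (Num.truncn (4 * m%:R ^+ 2 * L / (1 - r))).+1.
  by rewrite [leRHS]mulrC -ler_pdivrMr//; apply: ltW; exact: truncnS_gt.
exists (BV + 3 * CW2 + 2 * (decorr C' N0 * (3 * CW)) + (3 * CW + B0) ^+ 2).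
move=> dO Omega P X n c n0 row hc.
set H := fun u => poisson (Q u) (gcent pi G u) in lH.
set W := fun u => kact (Q u) (H u).
have [bH _ _] := lH; have [bW _ _] := lW; have [bV _ _] := lV.
have [bW2 _ _] := lW2.
pose M w := mart X n H n w; pose D w := \sum_(k < n) drift X n W k w.
have bM : bm M by exact: past_bm (past_mart row lH n).
have bD : bm D by exact: bm_drift_sum.
pose e : R := pi_sum n G - c.
have be : bm (fun w => D w + e) by apply: bmD => //; exact: bm_cst.
have DB w : `|D w + e| <= 3 * CW + B0.
  by apply: le_trans (ler_normD _ _) (lerD _ _) => //; exact: drift_bound.
have -> : \int[P]_w ((row_sum X n G w - c) ^+ 2) =
  \int[P]_w (M w ^+ 2) + 2 * \int[P]_w (M w * D w) + \int[P]_w ((D w + e) ^+ 2).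
  transitivity (\int[P]_w (M w ^+ 2 + 2 * (M w * D w) + (D w + e) ^+ 2 + 2 * e * M w)).
    apply: eq_Rintegral => w _.
    have -> : row_sum X n G w - c = M w + D w + e.
      by rewrite /M /D /W /H -(row_sum_poisson _ _ _ lG) /e; ring.
    ring.
  have b1 : bm (fun w => 2 * (M w * D w)) by apply: bmM; [exact: bm_cst|exact: bmM].
  have b2 : bm (fun w => M w ^+ 2) by exact: bmX.
  have b3 : bm (fun w => (D w + e) ^+ 2) by exact: bmX.
  rewrite intD//; [|by apply: bmD => //; exact: bmD|by apply: bmM => //; exact: bm_cst].
  rewrite intZ// (int_mart row lH (leqnn n)) mulr0 addr0.
  rewrite intD//; last exact: bmD.
  by rewrite intD// intZ//; exact: bmM.
(* [int_mdiff_sqr] has W^2 at X_k, whereas [mvar] is evaluated at X_(k+1); the discrepancy is the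
   drift of W^2. *)
have M2 : \int[P]_w (M w ^+ 2) = \int[P]_w row_sum X n (mvar G) w -
   \int[P]_w (\sum_(k < n) drift X n (fun u x => W u x ^+ 2) k w).
  rewrite /M (int_mart_sqr row lH (leqnn n)).
  have bHX u k : bm (fun w => H u (X k w)) by apply: bm_RV; exact: bH.
  have bWX u k : bm (fun w => W u (X k w)) by apply: bm_RV; exact: bW.
  rewrite (@int_sum _ _ _ P _ n (fun k w => mvar G (grid n k.+1) (X k.+1 w)))//; last first.
    by move=> i; apply: bm_RV.
  rewrite (@int_sum _ _ _ P _ n (fun k w => drift X n (fun u x => W u x ^+ 2) k w))//;
    last by move=> i; apply: bmB; exact: bmX.
  rewrite -sumrB; apply: eq_bigr => k _.
  rewrite (int_mdiff_sqr row lH)//.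
  have bdr : bm (drift X n (fun u x => W u x ^+ 2) k) by apply: bmB; exact: bmX.
  have bmv : bm (fun w => mvar G (grid n k.+1) (X k.+1 w)) by apply: bm_RV; exact: bV.
  rewrite -[RHS]intB// -[LHS]intB//; [|by apply: bmX; exact: bHX|by apply: bmX; exact: bWX].
  by apply: eq_Rintegral => w _; rewrite /mvar /drift -/(H _) -/(W _); ring.
set I1 := \int[P]_w (M w ^+ 2) in M2 *; set I2 := \int[P]_w (M w * D w).
set I3 := Rintegral P _ _.
set J1 := \int[P]_w row_sum X n (mvar G) w in M2.
set J2 := \int[P]_w _ in M2.
have hJ1 : `|J1 - pi_sum n (mvar G)| <= BV by exact: hBV.
have hJ2 : `|J2| <= 3 * CW2.
  by apply: int_bound => //; [exact: bm_drift_sum|move=> w; exact: drift_bound].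
have hI2 : `|I2| <= decorr C' N0 * (3 * CW) by exact: (past_drift_cov n0 row lH hN0 lW).
have hI3 : `|I3| <= (3 * CW + B0) ^+ 2.
  apply: int_bound => //; first exact: bmX.
  move=> w; rewrite normrX lerXn2r// nnegrE; apply: le_trans (DB w); exact: normr_ge0.
have -> : I1 + 2 * I2 + I3 - pi_sum n (mvar G) =
   (J1 - pi_sum n (mvar G)) - J2 + 2 * I2 + I3 by rewrite M2; ring.
apply: le_trans (ler_normD _ _) (lerD _ hI3).
apply: le_trans (ler_normD _ _) (lerD _ _).
  by apply: le_trans (ler_normB _ _) (lerD _ _).
by rewrite normrM ger0_norm//; apply: ler_wpM2l.
Qed.

Lemma avarE C G u : lipfam C G ->
  cvgn (autocov_series Q pi G u) /\ avar Q pi G u = \int[pi u]_x mvar G u x.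
Proof.
move=> lG; have lF := lipfam_cent lG; have F0 := int_cent u lG.
have [bF FM _] := lF.
have Q1 x : Q u x setT = 1%E by [].
have c := cvg_autocov (Qpi u) m0 r0 r1 (@contract u) (bF u) (FM u) F0.
have sE : autocov_series Q pi G u =
    series (fun j => \int[pi u]_x (gcent pi G u x * iter j.+1 (kact (Q u)) (gcent pi G u) x)).
  by apply/funext => n; rewrite /autocov_series !seriesEord/=; apply: eq_bigr => j _;
    rewrite /autocov (kact_kiter Q1 j.+1 (bF u)).
split; first by rewrite sE; apply/cvg_ex; eexists; exact: c.
rewrite /avar sE (cvg_lim _ c)//.
exact: (avar_poisson (Qpi u) m0 r0 r1 (@contract u) (bF u) (FM u) F0).
Qed.

Lemma smean_lip C G : lipfam C G -> forall u v,
  `|smean pi G u - smean pi G v| <= (C + 2 * L * c0 * C) * `|u - v|.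
Proof. by move=> lG u v; exact: pi_fam_lip. Qed.

Lemma avar_lip C G : lipfam C G -> exists C', forall u v,
  `|avar Q pi G u - avar Q pi G v| <= C' * `|u - v|.
Proof.
move=> lG; have [C' lV] := lipfam_mvar lG; eexists => u v.
by rewrite (avarE u lG).2 (avarE v lG).2; exact: pi_fam_lip lV.
Qed.

Local Notation integral01 f := (\int[@lebesgue_measure R]_(u in `[0, 1]) f u).

Lemma row_mean01 C G : lipfam C G -> exists B, forall (dO : measure_display)
    (Omega : measurableType dO) (P : probability Omega R) (X : nat -> {RV P >-> E}) n,
  (0 < n)%N -> (forall k, (k < n)%N -> markov_step X k (Q (grid n k.+1))) ->
  `|\int[P]_w row_sum X n G w - n%:R * integral01 (smean pi G)| <= B.
Proof.
move=> lG; have [B hB] := row_mean lG.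
exists (B + (C + 2 * L * c0 * C)) => dO Omega P X n n0 row.
rewrite -(subrK (pi_sum n G) (\int[P]_w _)) -addrA.
apply: le_trans (ler_normD _ _) (lerD _ _); first exact: hB.
exact: (riemann_sum (smean_lip lG)).
Qed.

Lemma row_variance01 C G B0 : lipfam C G -> exists B, forall (dO : measure_display)
    (Omega : measurableType dO) (P : probability Omega R) (X : nat -> {RV P >-> E}) n c,
  (0 < n)%N -> (forall k, (k < n)%N -> markov_step X k (Q (grid n k.+1))) ->
  `|c - n%:R * integral01 (smean pi G)| <= B0 ->
  `|\int[P]_w ((row_sum X n G w - c) ^+ 2) - n%:R * integral01 (avar Q pi G)| <= B.
Proof.
move=> lG; have [C' lV] := avar_lip lG.
(* The centring is now compared with n times the integral, so the Riemann error of [smean] is added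
   to B0. *)
have [B hB] := row_variance (C + 2 * L * c0 * C + B0) lG.
exists (B + C') => dO Omega P X n c n0 row hc.
rewrite -(subrK (pi_sum n (mvar G)) (\int[P]_w _)) -addrA.
apply: le_trans (ler_normD _ _) (lerD _ _).
  apply: hB => //; rewrite -(subrK (n%:R * integral01 (smean pi G)) (pi_sum n G)) -addrA.
  apply: le_trans (ler_normD _ _) (lerD _ _); last by rewrite distrC.
  exact: (riemann_sum (smean_lip lG)).
have -> : pi_sum n (mvar G) = \sum_(k < n) avar Q pi G (grid n k.+1).
  by apply: eq_bigr => k _; rewrite (avarE _ lG).2.
exact: (riemann_sum lV).
Qed.

End kernel_family.

(** * Twisted operator *)

Section unit_circle.
Context (R : realType).
Local Notation C := R[i].
Local Notation nc := Normc.normc.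

Definition cis (a : R) : C := (cos a +i* sin a)%C.

Lemma cisD a b : cis (a + b) = cis a * cis b.
Proof. by rewrite /cis cosD sinD; apply/eqP; rewrite eq_complex /= eqxx/= addrC. Qed.

Lemma cis0 : cis 0 = 1.
Proof. by rewrite /cis cos0 sin0. Qed.

Lemma cexp_cis (t a : R) : cexp ((0 +i* t)%C * a%:C%C) = cis (t * a).
Proof. by rewrite /cexp /cis /= !mul0r mulr0 subr0 add0r expR0 mul1r. Qed.

Lemma nc_cis a : nc (cis a) = 1.
Proof. by rewrite /Normc.normc /= cos2Dsin2 sqrtr1. Qed.

Lemma nc_le_abs (z : C) : nc z <= `|complex.Re z| + `|complex.Im z|.
Proof.
case: z => a b /=; rewrite -[leRHS]ger0_norm ?addr_ge0// -sqrtr_sqr.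
apply: ler_wsqrtr; rewrite sqrrD !real_normK ?num_real//.
by rewrite lerD2r lerDl mulrn_wge0// mulr_ge0.
Qed.

Lemma Re_le_nc (z : C) : `|complex.Re z| <= nc z.
Proof. by case: z => a b /=; rewrite -sqrtr_sqr; apply: ler_wsqrtr; rewrite lerDl sqr_ge0. Qed.

Lemma nc_ge0 (z : C) : 0 <= nc z.
Proof. exact: le_trans (Re_le_nc z). Qed.

Lemma lip_of_derive (f df : R -> R) : (forall x, is_derive x (1 : R) f (df x)) ->
  (forall x, `|df x| <= 1) -> forall a b, `|f a - f b| <= `|a - b|.
Proof.
move=> fd df1 a b; wlog ab : a b / a <= b => [h|].
  by have [ab|/ltW ab] := leP a b; [exact: h|rewrite distrC (distrC a); exact: h].
have [c _ e] := @MVT_segment R f df a b ab (fun x _ => fd x)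
  (derivable_within_continuous (fun x _ => @ex_derive _ _ _ _ _ _ _ (fd x))).
by rewrite distrC e normrM (distrC a) -[leRHS]mul1r ler_wpM2r.
Qed.

Lemma nc_cisB a b : nc (cis a - cis b) <= 2 * `|a - b|.
Proof.
apply: le_trans (nc_le_abs _) _; rewrite mulr_natl mulr2n; apply: lerD => /=.
  apply: (@lip_of_derive _ (fun x => - sin x)) => x.
  by rewrite normrN ler_norml sin_geN1 sin_le1.
apply: (@lip_of_derive _ cos) => x.
by rewrite ler_norml cos_geN1 cos_le1.
Qed.

End unit_circle.

Section complex_integral.
Context d (T : measurableType d) (R : realType).
Local Notation C := R[i].
Local Notation nc := Normc.normc.
Implicit Types f g : T -> C.

Definition cbm f := bm (fun x => complex.Re (f x)) /\ bm (fun x => complex.Im (f x)).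

Lemma cbm_bmfun f : cbm f -> bmfun f.
Proof.
move=> [[mr [A rA]] [mi [B iB]]]; split=> //; exists (A + B) => x.
by apply: le_trans (nc_le_abs _) _; exact: lerD.
Qed.

Lemma cbmD f g : cbm f -> cbm g -> cbm (fun x => f x + g x).
Proof.
move=> [fr fi] [gr gi]; split.
  by rewrite (_ : (fun x => _) = fun x => complex.Re (f x) + complex.Re (g x));
    [exact: bmD|apply/funext => x; case: (f x); case: (g x)].
by rewrite (_ : (fun x => _) = fun x => complex.Im (f x) + complex.Im (g x));
  [exact: bmD|apply/funext => x; case: (f x); case: (g x)].
Qed.

Lemma cbmM f g : cbm f -> cbm g -> cbm (fun x => f x * g x).
Proof.
move=> [fr fi] [gr gi]; split.
  rewrite (_ : (fun x => _) = fun x => complex.Re (f x) * complex.Re (g x) -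
    complex.Im (f x) * complex.Im (g x)).
    by apply: bmB; exact: bmM.
  by apply/funext => x; case: (f x); case: (g x).
rewrite (_ : (fun x => _) = fun x => complex.Re (f x) * complex.Im (g x) +
    complex.Im (f x) * complex.Re (g x)).
  by apply: bmD; exact: bmM.
by apply/funext => x; case: (f x); case: (g x).
Qed.

Lemma cbm_cst (c : C) : cbm (fun=> c).
Proof. by split; exact: bm_cst. Qed.

Lemma cbmB f g : cbm f -> cbm g -> cbm (fun x => f x - g x).
Proof.
move=> bf bg; rewrite (_ : (fun x => _) = fun x => f x + (-1) * g x).
  by apply: cbmD => //; apply: cbmM => //; exact: cbm_cst.
by apply/funext => x; rewrite mulN1r.
Qed.

Lemma cbm_cis (h : T -> R) : bm h -> cbm (fun x => cis (h x)).
Proof.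
move=> [mh _]; split; split => /=.
- by apply: measurableT_comp => //; apply: continuous_measurable_fun; exact: continuous_cos.
- by exists 1 => x; rewrite ler_norml cos_geN1 cos_le1.
- by apply: measurableT_comp => //; apply: continuous_measurable_fun; exact: continuous_sin.
- by exists 1 => x; rewrite ler_norml sin_geN1 sin_le1.
Qed.

Lemma bm_nc f : cbm f -> bm (fun x => nc (f x)).
Proof.
move=> bf; have [[mr _] [mi _]] := bf; have [_ _ [M fM]] := cbm_bmfun bf.
split; last by exists M => x; rewrite ger0_norm// nc_ge0.
rewrite (_ : (fun x => _) = fun x => Num.sqrt (complex.Re (f x) ^+ 2 + complex.Im (f x) ^+ 2));
  last by apply/funext => x; case: (f x).
apply: measurableT_comp; first by apply: continuous_measurable_fun; exact: sqrt_continuous.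
by apply: measurable_funD; exact: measurable_funX.
Qed.

Variables (mu : {measure set T -> \bar R}) (mu1 : mu setT = 1%E).

Lemma cintegralD f g : cbm f -> cbm g ->
  cintegral mu (fun x => f x + g x) = cintegral mu f + cintegral mu g.
Proof.
move=> [fr fi] [gr gi]; apply/eqP; rewrite eq_complex/= -!intD//.
apply/andP; split; apply/eqP; apply: eq_Rintegral => x _; by case: (f x); case: (g x).
Qed.

Lemma cintegralM c f : cbm f ->
  cintegral mu (fun x => c * f x) = c * cintegral mu f.
Proof.
move=> [fr fi]; case: c => a b; apply/eqP; rewrite eq_complex/= -!intZ//.
have bZ k h : bm h -> bm (fun x : T => k * h x : R) by move=> bh; apply: bmM => //; exact: bm_cst.
rewrite -intB//; [|exact: bZ..]; rewrite -intD//; [|exact: bZ..].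
apply/andP; split; apply/eqP; apply: eq_Rintegral => x _; by case: (f x).
Qed.

Lemma cintegral_cst c : cintegral mu (fun=> c) = c.
Proof. by rewrite /cintegral !int_cst//; case: c. Qed.

(* Testing against the conjugate of the integral reduces the modulus inequality to a real one. *)
Lemma nc_cintegral f : cbm f -> nc (cintegral mu f) <= \int[mu]_x nc (f x).
Proof.
move=> bf; have [fr fi] := bf.
set z := cintegral mu f; have bn := bm_nc bf.
have [z0|zn0] := eqVneq (nc z) 0.
  by rewrite z0 -(int_cst mu1 0); apply: int_le => //; [exact: bm_cst|move=> x; exact: nc_ge0].
have zp : 0 < nc z by rewrite lt_neqAle eq_sym zn0 nc_ge0.
rewrite -(ler_pM2l zp) -intZ//.
have bZ k h : bm h -> bm (fun x : T => k * h x : R) by move=> bh; apply: bmM => //; exact: bm_cst.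
have -> : nc z * nc z = \int[mu]_x (complex.Re z * complex.Re (f x) + complex.Im z * complex.Im (f x)).
  rewrite intD//; [|exact: bZ..]; rewrite !intZ// -expr2 /= sqr_sqrtr; last first.
    by rewrite addr_ge0// sqr_ge0.
  by rewrite !expr2.
apply: int_le => //; [by apply: bmD; exact: bZ|exact: bZ|move=> x].
case: z {zn0 zp} => a b; case: (f x) => c e.
have -> : nc (a +i* b)%C = nc (a -i* b)%C by rewrite /= sqrrN.
rewrite -Normc.normcM; apply: le_trans (Re_le_nc _); apply: le_trans (ler_norm _).
by rewrite /= mulNr opprK.
Qed.

End complex_integral.

(** * A unimodular spectral value when the variance vanishes *)

Section spectral_obstruction.
Context d (E : measurableType d) (R : realType).
Local Notation C := R[i].
Local Notation nc := Normc.normc.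
Variables (Q : R -> R.-pker E ~> E) (mu : probability E R) (g : R -> E -> R).
Variables (u t : R) (h : E -> R) (b0 : R).
Hypotheses (Qmu : invariant (Q u) mu) (bg : bm (g u)) (bh : bm h).
Hypothesis heq : forall x, h x - kact (Q u) h x = g u x - b0.
Hypothesis var0 : \int[mu]_x (h x ^+ 2 - kact (Q u) h x ^+ 2) <= 0.
Local Notation Th := (kact (Q u) h).
Local Notation Tw := (twisted Q g u (0 +i* t)%C).
Implicit Types f : E -> C.

Let bTh : bm Th. Proof. exact: bm_pkact. Qed.
Let bZ k (p : E -> R) : bm p -> bm (fun x => k * p x).
Proof. by move=> bp; apply: bmM => //; exact: bm_cst. Qed.
Let bcis (p : E -> R) : bm p -> cbm (fun x => cis (t * p x)).
Proof. by move=> bp; apply: cbm_cis; exact: bZ. Qed.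

Lemma twistedE f x : Tw f x = cintegral (Q u x) (fun y => cis (t * g u y) * f y).
Proof. by rewrite /twisted; congr cintegral; apply/funext => y; rewrite cexp_cis. Qed.

Let bw f : cbm f -> cbm (fun y => cis (t * g u y) * f y).
Proof. by move=> bf; apply: cbmM => //; exact: bcis. Qed.

Lemma twistedD f f' x : cbm f -> cbm f' ->
  Tw (fun y => f y + f' y) x = Tw f x + Tw f' x.
Proof.
move=> bf bf'; rewrite !twistedE -cintegralD//; [|exact: bw..].
by congr cintegral; apply/funext => y; rewrite mulrDr.
Qed.

Lemma twistedM c f x : cbm f -> Tw (fun y => c * f y) x = c * Tw f x.
Proof.
move=> bf; rewrite !twistedE -cintegralM//; last exact: bw.
by congr cintegral; apply/funext => y; rewrite mulrCA.
Qed.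

Lemma cbm_twisted f : cbm f -> cbm (Tw f).
Proof.
move=> bf; have [b1 b2] := bw bf.
rewrite (_ : Tw f = fun x => cintegral (Q u x) (fun y => cis (t * g u y) * f y)).
  by split; exact: bm_pkact.
by apply/funext => x; exact: twistedE.
Qed.

Lemma nc_twisted f x : cbm f -> nc (Tw f x) <= kact (Q u) (fun y => nc (f y)) x.
Proof.
move=> bf; rewrite twistedE; apply: le_trans (nc_cintegral _ (bw bf)) _ => //.
by apply: int_le => //; [exact/bm_nc/bw|exact: bm_nc|move=> y; rewrite Normc.normcM nc_cis mul1r].
Qed.

Let lam : C := cis (t * b0).
Let lam' : C := cis (- (t * b0)).
Let lamK : lam * lam' = 1. Proof. by rewrite -cisD subrr cis0. Qed.

(** For a true eigenfunction with value [lam] this sequence would be constant in k; here its terms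
    agree only [mu]-almost everywhere. *)
Definition eigf (k : nat) : E -> C :=
  iter k (fun f x => lam' * Tw f x) (fun x => cis (t * Th x)).

Lemma eigfS k x : eigf k.+1 x = lam' * Tw (eigf k) x. Proof. by []. Qed.

Lemma cbm_eigf k : cbm (eigf k).
Proof.
elim: k => [|k ih]; first exact: bcis.
by apply: cbmM; [exact: cbm_cst|exact: cbm_twisted].
Qed.

Lemma nc_eigf k x : nc (eigf k x) <= 1.
Proof.
elim: k x => [|k ih] x; first by rewrite nc_cis.
rewrite eigfS Normc.normcM nc_cis mul1r; apply: le_trans (nc_twisted _ (cbm_eigf k)) _.
rewrite -[leRHS](@int_cst _ _ _ (Q u x) _ 1)//; apply: int_le => //; first exact/bm_nc/cbm_eigf.
exact: bm_cst.
Qed.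

Lemma kernel_var x : kact (Q u) (fun y => (h y - Th x) ^+ 2) x =
  kact (Q u) (fun y => h y ^+ 2) x - Th x ^+ 2.
Proof.
have bh2 : bm (fun y => h y ^+ 2) by exact: bmX.
rewrite (_ : (fun y => _) = fun y => h y ^+ 2 - (2 * Th x) * h y + Th x ^+ 2); last first.
  by apply/funext => y; ring.
rewrite kactD; [|by apply: bmB => //; exact: bZ|exact: bm_cst].
rewrite kactB//; last exact: bZ.
by rewrite kactZ// kact_cst; ring.
Qed.

(** By invariance, the quantity assumed nonpositive is the mean of the conditional variance of h(y)
    given x, so h is almost surely constant along transitions from x. *)
Lemma int_kernel_var : \int[mu]_x kact (Q u) (fun y => (h y - Th x) ^+ 2) x =
  \int[mu]_x (h x ^+ 2 - Th x ^+ 2).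
Proof.
have bh2 : bm (fun y => h y ^+ 2) by exact: bmX.
have bT2 : bm (fun y => Th y ^+ 2) by exact: bmX.
under eq_Rintegral do rewrite kernel_var.
by rewrite !intB ?invariant_int//; exact: bm_pkact.
Qed.

(** By the Poisson equation [eigf 1] is the kernel average of exp(i t h), and its distance to
    [eigf 0] is at most the average of 2 |t| |h(y) - T h(x)|. Splitting this into a small constant
    and a multiple of the conditional variance leaves only the constant after integration. *)
Lemma eigf1_eigf0 : \int[mu]_x nc (eigf 1 x - eigf 0 x) = 0.
Proof.
have bd : bm (fun x => nc (eigf 1 x - eigf 0 x)).
  by apply: bm_nc; apply: cbmB; exact: cbm_eigf.
apply/le_anti/andP; split; last first.
  by rewrite -(@int_cst _ _ _ mu _ 0)//; apply: int_le => //;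
    [exact: bm_cst|move=> x; exact: nc_ge0].
apply/ler_addgt0Pl => e e0; rewrite addr0.
(* c stays positive at t = 0, and s is chosen to make the constant part c s equal to e. *)
pose c := `|t| + 1.
have c0 : 0 < c by rewrite ltr_wpDl.
pose s := e / c.
have s0 : 0 < s by rewrite divr_gt0.
have bv x : bm (fun y => (h y - Th x) ^+ 2).
  by apply: bmX; apply: bmB => //; exact: bm_cst.
have bkv : bm (fun x => kact (Q u) (fun y => (h y - Th x) ^+ 2) x).
  under eq_fun do rewrite kernel_var.
  by apply: bmB; [apply: bm_pkact|]; exact: bmX.
have pt x : nc (eigf 1 x - eigf 0 x) <=
    c * s + c / s * kact (Q u) (fun y => (h y - Th x) ^+ 2) x.
  have -> : eigf 1 x - eigf 0 x =
      cintegral (Q u x) (fun y => cis (t * h y) + (-1) * cis (t * Th x)).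
    have b1 : cbm (fun y => cis (t * h y)) by exact: bcis.
    rewrite cintegralD//; [|by apply: cbmM; exact: cbm_cst].
    rewrite cintegral_cst// mulN1r; congr (_ - _).
    rewrite /= twistedE -cintegralM//; last by apply: bw; exact: bcis.
    congr cintegral; apply/funext => y; rewrite /lam' -!cisD; congr cis.
    (* The exponents combine because g(u, y) + T h(y) - b0 = h(y). *)
    have := heq y => /eqP; rewrite subr_eq => /eqP ->; ring.
  have b2 : cbm (fun y => cis (t * h y) + (-1) * cis (t * Th x)).
    by apply: cbmD; [exact: bcis|apply: cbmM; exact: cbm_cst].
  apply: le_trans (nc_cintegral _ b2) _ => //.
  have -> : c * s + c / s * kact (Q u) (fun y => (h y - Th x) ^+ 2) x =
      \int[Q u x]_y (c * s + c / s * (h y - Th x) ^+ 2).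
    by rewrite intD//; [rewrite int_cst// intZ|exact: bm_cst|exact: bZ].
  apply: int_le => //; [exact: bm_nc|by apply: bmD; [exact: bm_cst|exact: bZ]|move=> y].
  rewrite mulN1r; apply: le_trans (nc_cisB _ _) _.
  rewrite -mulrBr normrM; set a := `|h y - Th x|.
  have <- : a ^+ 2 = (h y - Th x) ^+ 2 by rewrite real_normK ?num_real.
  (* AM-GM *)
  have am : 2 * a <= s + s^-1 * a ^+ 2.
    have e2 : s * (s + s^-1 * a ^+ 2) = s ^+ 2 + a ^+ 2 by field; rewrite gt_eqF.
    rewrite -(ler_pM2l s0) e2.
    by have := sqr_ge0 (s - a); rewrite sqrrB; lra.
  have -> : c * s + c / s * a ^+ 2 = c * (s + s^-1 * a ^+ 2) by ring.
  have ct : `|t| <= c by rewrite /c lerDl.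
  have a0 : 0 <= 2 * a by apply: mulr_ge0 => //; exact: normr_ge0.
  by rewrite mulrCA; exact: ler_pM.
apply: (@le_trans _ _ (\int[mu]_x (c * s + c / s * kact (Q u) (fun y => (h y - Th x) ^+ 2) x))).
  by apply: int_le => //; apply: bmD; [exact: bm_cst|exact: bZ].
rewrite intD//; [|exact: bm_cst|exact: bZ].
rewrite int_cst// intZ// int_kernel_var.
have -> : c * s = e by rewrite /s mulrC divfK// gt_eqF.
rewrite gerDl; apply: mulr_ge0_le0 => //.
by rewrite divr_ge0// ltW.
Qed.

(** The modulus of the twisted operator is dominated by the kernel and [mu] is invariant, so one
    more application does not increase the mean deviation; the step adds only the deviation of
    [eigf 1], which is null. *)
Lemma eigf_eigf0 k : \int[mu]_x nc (eigf k x - eigf 0 x) = 0.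
Proof.
have bd j : bm (fun x => nc (eigf j x - eigf 0 x)).
  by apply: bm_nc; apply: cbmB; exact: cbm_eigf.
elim: k => [|k ih].
  by apply: int_eq0 => // x; rewrite subrr Normc.normc0.
apply/le_anti/andP; split; last first.
  by rewrite -(@int_cst _ _ _ mu _ 0)//; apply: int_le => //;
    [exact: bm_cst|move=> x; exact: nc_ge0].
rewrite -[leRHS]addr0 -{1}ih -[X in _ <= _ + X]eigf1_eigf0 -[X in _ <= X + _](invariant_int Qmu)//.
rewrite -intD//; last exact: bm_pkact.
apply: int_le => //; first by apply: bmD => //; exact: bm_pkact.
move=> x.
have -> : eigf k.+1 x - eigf 0 x =
    lam' * Tw (fun y => eigf k y - eigf 0 y) x + (eigf 1 x - eigf 0 x).
  have b0' := cbm_eigf 0; have bk := cbm_eigf k.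
  have -> : (fun y => eigf k y - eigf 0 y) = (fun y => eigf k y + (-1) * eigf 0 y).
    by apply/funext => y; rewrite mulN1r.
  rewrite twistedD//; last by apply: cbmM => //; exact: cbm_cst.
  rewrite twistedM// mulN1r mulrBr /=; set p := lam' * _; set p' := lam' * _.
  by rewrite addrA subrK.
apply: le_trans (le_normcD _ _) _; apply: lerD => //.
rewrite Normc.normcM nc_cis mul1r; apply: nc_twisted.
by apply: cbmB; exact: cbm_eigf.
Qed.

Lemma sup_norm_ge f x : cbm f -> nc (f x) <= sup_norm f.
Proof.
move=> bf; have [_ _ [M fM]] := cbm_bmfun bf.
apply: sup_upper_bound; last by exists x.
by split; [exists (nc (f x)), x|exists M => _ [y _ <-]].
Qed.

(* The sums [\sum_(k < N) eigf k] have norm at least [N], but their images under [lam - Tw]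
   telescope, so that [lam - Tw] has no bounded inverse. *)
Lemma twisted_spectrum : spectrum Tw lam.
Proof.
move=> [S [[_ _ [M SM]] inv]].
(* The image of the sum has norm at most 2, so an inverse of norm at most |M| would bound the sum by
   2 |M|. *)
pose N := (Num.truncn (`|M| * 2)).+1.
have NM : `|M| * 2 < N%:R by exact: truncnS_gt.
pose A (n : nat) x := \sum_(k < n) eigf k x.
have bA n : cbm (A n).
  elim: n => [|n ih].
    by rewrite (_ : A 0%N = fun=> 0); [exact: cbm_cst|apply/funext => x; rewrite /A big_ord0].
  rewrite (_ : A n.+1 = fun x => A n x + eigf n x).
    by apply: cbmD => //; exact: cbm_eigf.
  by apply/funext => x; rewrite /A big_ord_recr.
have TA n x : lam * A n x - Tw (A n) x = lam * (eigf 0 x - eigf n x).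
  elim: n => [|n ih].
    (* Zero is written as a product so that [twistedM] computes its image. *)
    have A0 : A 0%N = fun=> 0 * 0 by apply/funext => y; rewrite /A big_ord0 mulr0.
    rewrite A0 twistedM; last exact: cbm_cst.
    by rewrite !mul0r mulr0 !subrr mulr0.
  have -> : A n.+1 = fun x => A n x + eigf n x.
    by apply/funext => y; rewrite /A big_ord_recr.
  rewrite twistedD//; last exact: cbm_eigf.
  have -> : Tw (eigf n) x = lam * eigf n.+1 x by rewrite /= mulrA lamK mul1r.
  have -> : Tw (A n) x = lam * A n x - lam * (eigf 0 x - eigf n x).
    by rewrite -ih opprB addrCA subrr addr0.
  ring.
pose B x := lam * A N x - Tw (A N) x.
have bB : cbm B.
  by apply: cbmB; [apply: cbmM => //; exact: cbm_cst|exact: cbm_twisted].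
have SB : S B = A N by case: (inv _ (cbm_bmfun (bA N))).
have B2 : sup_norm B <= 2.
  apply: ge_sup; first by exists (nc (B point)), point.
  move=> _ [x _ <-]; rewrite /B TA Normc.normcM nc_cis mul1r.
  apply: le_trans (le_normcD _ _) _; rewrite normcN.
  by apply: (@le_trans _ _ (1 + 1)); [apply: lerD; exact: nc_eigf|].
have A2 x : nc (A N x) <= `|M| * 2.
  apply: le_trans (sup_norm_ge x (bA N)) _; rewrite -SB.
  apply: le_trans (SM _ (cbm_bmfun bB)) _.
  apply: (@le_trans _ _ (`|M| * sup_norm B)).
    apply: ler_wpM2r; last exact: ler_norm.
    exact: le_trans (nc_ge0 _) (sup_norm_ge point bB).
  by apply: ler_wpM2l.
have bd j : bm (fun x => nc (eigf j x - eigf 0 x)).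
  by apply: bm_nc; apply: cbmB; exact: cbm_eigf.
(* No good point is selected: N is everywhere at most |A_N| plus the deviations from [eigf 0], and
   the deviations integrate to 0. *)
have : N%:R <= `|M| * 2; last by rewrite leNgt NM.
have -> : `|M| * 2 = \int[mu]_x (`|M| * 2 + \sum_(k < N) nc (eigf k x - eigf 0 x)).
  rewrite intD//; [|exact: bm_cst|exact: bm_sum].
  rewrite int_cst// (@int_sum _ _ _ mu _ N (fun k x => nc (eigf k x - eigf 0 x)))//.
  by rewrite big1 ?addr0// => k _; exact: eigf_eigf0.
rewrite -[leLHS](@int_cst _ _ _ mu)//; apply: int_le => //; first exact: bm_cst.
  by apply: bmD; [exact: bm_cst|exact: bm_sum].
move=> x; apply: le_trans (_ : nc (A N x) + \sum_(k < N) nc (eigf k x - eigf 0 x) <= _);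
  last by rewrite lerD2r.
have nsum n (p : nat -> C) : nc (\sum_(k < n) p k) <= \sum_(k < n) nc (p k).
  elim: n => [|n ih]; first by rewrite !big_ord0 Normc.normc0.
  by rewrite !big_ord_recr/=; apply: le_trans (le_normcD _ _) _; rewrite lerD2r.
have <- : nc (eigf 0 x *+ N) = N%:R by rewrite normcMn nc_cis.
have -> : eigf 0 x *+ N = A N x + - \sum_(k < N) (eigf k x - eigf 0 x).
  by rewrite /A -sumrN -big_split/=; under eq_bigr do rewrite opprB addrC subrK;
    rewrite sumr_const card_ord.
apply: le_trans (le_normcD _ _) _; rewrite normcN lerD2l.
exact: (nsum N (fun k => eigf k x - eigf 0 x)).
Qed.

End spectral_obstruction.

(** * Moments of the array *)

Lemma cvg_of_bounded_dev (R : realType) (x : nat -> \bar R) (b B : R) :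
  (forall n, (0 < n)%N -> exists2 y, x n = y%:E & `|y - n%:R * b| <= B) ->
  ((n%:R^-1)%:E * x n)%E @[n --> \oo] --> b%:E /\
  (ereal_sup [set `|x n - (n%:R * b)%:E|%E | n in [set n : nat | (1 <= n)%N]] < +oo)%E.
Proof.
move=> h; have [y0 _ hy0] := h 1%N isT.
have B0 : 0 <= B by apply: le_trans hy0.
have xE n : (0 < n)%N -> x n = (fine (x n))%:E by move=> n0; have [y -> _] := h n n0.
split; last first.
  apply: (@le_lt_trans _ _ B%:E); last exact: ltry.
  apply: ge_ereal_sup => _ /= [n n0 <-]; have [y -> hy] := h n n0.
  by rewrite -EFinB abse_EFin lee_fin.
(* The term of index 0 may be infinite; after the shift all terms are finite and the limit can be
   taken in the reals. *)
rewrite -(@cvg_shiftS _ (fun n => ((n%:R^-1)%:E * x n)%E)).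
have -> : (fun n : nat => ((n.+1%:R^-1)%:E * x n.+1)%E) =
    EFin \o (fun n => n.+1%:R^-1 * fine (x n.+1)).
  by apply/funext => n /=; rewrite EFinM -xE.
apply: cvg_EFin; first exact: nearW.
apply/cvgrPdist_le => e e0.
have := @cvg_harmonic R => /cvgrPdist_le/(_ (e / (B + 1))).
rewrite divr_gt0 ?ltr_wpDl// => /(_ isT); apply: filterS => n.
rewrite sub0r normrN ger0_norm ?invr_ge0//= => hn.
have n0 : 0 < n.+1%:R :> R by rewrite ltr0n.
have [y xy hy] := h n.+1 isT.
rewrite xy /= distrC.
have -> : n.+1%:R^-1 * y - b = n.+1%:R^-1 * (y - n.+1%:R * b).
  by field; rewrite gt_eqF.
rewrite normrM ger0_norm ?invr_ge0//.
apply: (@le_trans _ _ (e / (B + 1) * (B + 1))).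
  by apply: ler_pM => //; rewrite ?invr_ge0//; apply: le_trans hy _; rewrite lerDl.
by rewrite divfK// gt_eqF// ltr_wpDl.
Qed.

Section positive_indices.
Context (R : realType).
Implicit Types F G : nat -> \bar R.

Lemma eq_image_pos F G : (forall n, (1 <= n)%N -> F n = G n) ->
  [set F n | n in [set n : nat | (1 <= n)%N]] = [set G n | n in [set n : nat | (1 <= n)%N]].
Proof. by move=> FG; apply/seteqP; split => _ [n n1 <-]; exists n => //; rewrite FG. Qed.

Lemma eq_cvg_pos F G (l : \bar R) : (forall n, (1 <= n)%N -> F n = G n) ->
  F n @[n --> \oo] --> l -> G n @[n --> \oo] --> l.
Proof.
move=> FG; rewrite -(cvg_shiftS F) -(cvg_shiftS G).
by rewrite (_ : (fun n => G n.+1) = (fun n => F n.+1))//; apply/funext => n; rewrite FG.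
Qed.

End positive_indices.

Section moments.
Context d (E : measurableType d) (R : realType).
Variables (Q : R -> R.-pker E ~> E) (pi : R -> probability E R).
Variables (L r : R) (m : nat).
Hypotheses (Qpi : forall u, invariant (Q u) (pi u)).
Hypotheses (L0 : 0 <= L) (m0 : (0 < m)%N) (r0 : 0 <= r) (r1 : r < 1).
Hypothesis contract : forall u f (M : R), bm f -> (forall x, `|f x| <= M) ->
  forall x y, `|iter m (kact (Q u)) f x - iter m (kact (Q u)) f y| <= r * M.
Hypothesis lipQ : forall u v f (M : R), bm f -> (forall x, `|f x| <= M) ->
  forall x, `|kact (Q u) f x - kact (Q v) f x| <= L * `|u - v| * M.
Variables (g : R -> E -> R) (C : R).
Hypothesis lg : lipfam C g.
Variables (dO : nat -> measure_display) (Omega : forall n, measurableType (dO n))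
  (P : forall n, probability (Omega n) R)
  (X : forall n, nat -> {RV (P n) >-> E}).
Arguments X : clear implicits.
Hypothesis row : forall n, (1 <= n)%N ->
  forall k, (k < n)%N -> markov_step (X n) k (Q (k.+1%:R / n%:R)).

Let Sn := array_sum g X.
Arguments Sn : clear implicits.
Let b := \int[lebesgue_measure]_(u in `[0, 1]) smean pi g u.
Let A2 := \int[lebesgue_measure]_(u in `[0, 1]) avar Q pi g u.

Lemma array_sumE n : array_sum g X (n:=n) = row_sum (X n) n g.
Proof. by apply/funext => w; rewrite /array_sum big_add1 big_mkord. Qed.

Let bS n : bm (Sn n).
Proof. by rewrite /Sn array_sumE; apply: bm_row_sum => //; case: lg. Qed.

Lemma expectationE n (Z : Omega n -> R) : bm Z -> ('E_(P n)[Z] = (\int[P n]_w Z w)%:E)%E.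
Proof. by move=> bZ; rewrite unlock int_EFin. Qed.

Lemma variance_int n (Z : Omega n -> R) : bm Z ->
  ('V_(P n)[Z] = (\int[P n]_w ((Z w - \int[P n]_w' Z w') ^+ 2))%:E)%E.
Proof.
move=> bZ; rewrite /variance covariance.unlock (expectationE bZ)/=.
rewrite -expectationE; last by apply: bmX; apply: bmB => //; exact: bm_cst.
by congr expectation; apply/funext => w /=; rewrite expr2.
Qed.

Lemma array_moments :
  [/\ (n%:R^-1)%:E * 'E_(P n)[Sn n] @[n --> \oo] --> b%:E &
      ereal_sup [set `| 'E_(P n)[Sn n] - (n%:R * b)%:E |
                | n in [set n : nat | (1 <= n)%N]] < +oo]%E /\
  [/\ (n%:R^-1)%:E * 'V_(P n)[Sn n] @[n --> \oo] --> A2%:E,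
      ereal_sup [set `| 'V_(P n)[Sn n] - (n%:R * A2)%:E |
                | n in [set n : nat | (1 <= n)%N]] < +oo &
      ereal_sup [set `| 'E_(P n)[fun w => ((Sn n w - b * n%:R) ^+ 2)%R]
                        - (n%:R * A2)%:E |
                | n in [set n : nat | (1 <= n)%N]] < +oo]%E.
Proof.
have [B hB] := row_mean01 Qpi L0 m0 r0 r1 contract lipQ lg.
(* The variance is centred at the mean, which is within B of n b; the last moment is centred at n b
   itself, whence 0 in place of B below. *)
have [B' hB'] := row_variance01 Qpi L0 m0 r0 r1 contract lipQ B lg.
have [B1 hB1] := row_variance01 Qpi L0 m0 r0 r1 contract lipQ 0 lg.
have e1 n : (0 < n)%N -> `|\int[P n]_w Sn n w - n%:R * b| <= B.
  by move=> n0; rewrite /Sn array_sumE; apply: hB => //; exact: row.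
have [c1 s1] : ((n%:R^-1)%:E * 'E_(P n)[Sn n] @[n --> \oo] --> b%:E /\
    ereal_sup [set `| 'E_(P n)[Sn n] - (n%:R * b)%:E |
                | n in [set n : nat | (1 <= n)%N]] < +oo)%E.
  apply: cvg_of_bounded_dev => n n0.
  by exists (\int[P n]_w Sn n w); [exact: expectationE|exact: e1].
have [c2 s2] : ((n%:R^-1)%:E * 'V_(P n)[Sn n] @[n --> \oo] --> A2%:E /\
    ereal_sup [set `| 'V_(P n)[Sn n] - (n%:R * A2)%:E |
                | n in [set n : nat | (1 <= n)%N]] < +oo)%E.
  apply: cvg_of_bounded_dev => n n0; eexists; first exact: variance_int.
  by have := e1 _ n0; rewrite /Sn array_sumE => h; apply: hB' => //; exact: row.
have [c3 s3] : ((n%:R^-1)%:E * 'E_(P n)[fun w => ((Sn n w - b * n%:R) ^+ 2)%R]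
     @[n --> \oo] --> A2%:E /\
    ereal_sup [set `| 'E_(P n)[fun w => ((Sn n w - b * n%:R) ^+ 2)%R]
                        - (n%:R * A2)%:E |
                | n in [set n : nat | (1 <= n)%N]] < +oo)%E.
  apply: cvg_of_bounded_dev => n n0; eexists.
    by apply: expectationE; apply: bmX; apply: bmB => //; exact: bm_cst.
  rewrite /Sn array_sumE; apply: hB1 => //; first exact: row.
  by rewrite mulrC subrr normr0.
by [].
Qed.

End moments.

(** * From the unit interval to all real parameters *)

Lemma half_norm (R : realType) (e : R) : 0 < e -> 0 < `|e / 2| < e.
Proof. by move=> e0; rewrite gtr0_norm ?divr_gt0//=; lra. Qed.

Section unit_interval.
Context (R : realType).
Implicit Types u v : R.

(* Composing the families with [clamp] makes the hypotheses hold for all real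
   parameters. *)
Definition clamp u : R := Num.max 0 (Num.min 1 u).

Lemma clamp_in u : clamp u \in `[0, 1].
Proof. by rewrite in_itv/= /clamp le_max lexx/= ge_max ler01/= ge_min lexx. Qed.

Lemma clamp_id u : u \in `[0, 1] -> clamp u = u.
Proof. by rewrite in_itv/= => /andP[u0 u1]; rewrite /clamp min_r// max_r. Qed.

Lemma clamp_lip u v : `|clamp u - clamp v| <= `|u - v|.
Proof.
wlog uv : u v / u <= v => [h|].
  by have [uv|/ltW uv] := leP u v; [exact: h|rewrite distrC (distrC u); exact: h].
have [h0 h1] : clamp u <= clamp v /\ clamp v - clamp u <= v - u.
  by rewrite /clamp /Num.max /Num.min; split; repeat case: ifP; lra.
by rewrite distrC (distrC u) !ger0_norm ?subr_ge0.
Qed.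

Lemma ratio_in n k : (0 < n)%N -> (k <= n)%N -> (k%:R / n%:R : R) \in `[0, 1].
Proof.
move=> n0 kn; rewrite in_itv/= divr_ge0//= ler_pdivrMr ?ltr0n//.
by rewrite mul1r ler_nat.
Qed.

Lemma lebesgue_unit : lebesgue_measure (`[0, 1] : set R) = 1%E.
Proof. by rewrite lebesgue_measure_itv/= lte_fin ltr01/= oppr0 adde0. Qed.

Lemma unit_integral_cst (c : R) : \int[@lebesgue_measure R]_(u in `[0, 1]) c = c.
Proof.
rewrite Rintegral_cst// -[RHS]mulr1; congr (_ * _).
transitivity (fine (lebesgue_measure (`[0, 1] : set R))) => //.
by rewrite lebesgue_unit.
Qed.

(** The integral is at least the minimum of f, which is attained on the compact interval and hence
    positive. *)
Lemma lip_integral_gt0 (f : R -> R) (C : R) :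
  (forall u v, `|f u - f v| <= C * `|u - v|) -> (forall u, 0 < f u) ->
  0 < \int[@lebesgue_measure R]_(u in `[0, 1]) f u.
Proof.
move=> fL f0.
have cf : {within `[0, 1], continuous f}.
  by apply: continuous_subspaceT; exact: (lip_continuous fL).
have [c _ hc] := EVT_min (@ler01 R) cf.
apply: (lt_le_trans (f0 c)); rewrite -[leLHS]unit_integral_cst.
apply: le_Rintegral => //; last exact: (lip_integrable fL).
apply: measurable_bounded_integrable => //; last exact: bounded_cst.
by apply: (@le_lt_trans _ _ 1%E); [rewrite -lebesgue_unit|rewrite ltry].
Qed.

End unit_interval.

Lemma tv_dist_int d (E : measurableType d) (R : realType)
    (mu nu : {measure set E -> \bar R}) (c M : R) (f : E -> R) :
  mu setT = 1%E -> nu setT = 1%E -> (tv_dist mu nu <= c%:E)%E ->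
  bm f -> (forall x, `|f x| <= M) ->
  `|\int[mu]_x f x - \int[nu]_x f x| <= c * M.
Proof.
move=> mu1 nu1 tv bf fM; have M0 : 0 <= M by apply: le_trans (fM point).
(* [tv_dist] tests functions bounded by 1, so f is divided by M, which excludes M = 0. *)
have [Mz|Mn0] := eqVneq M 0.
  have f0 x : f x = 0 by apply/eqP; rewrite -normr_le0 -Mz.
  by rewrite !int_eq0// subrr normr0 Mz mulr0.
have Mp : 0 < M by rewrite lt_neqAle eq_sym Mn0.
have bf' : bm (fun x => M^-1 * f x) by apply: bmM => //; exact: bm_cst.
have : `|\int[mu]_x (M^-1 * f x) - \int[nu]_x (M^-1 * f x)| <= c.
  rewrite -lee_fin; apply: le_trans tv; apply: ereal_sup_ubound.
  exists (fun x => M^-1 * f x) => //; split; first by case: bf'.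
  by move=> x; rewrite normrM gtr0_norm ?invr_gt0// ler_pdivrMl// mulr1.
rewrite !intZ// -mulrBr normrM gtr0_norm ?invr_gt0// ler_pdivrMl//.
by rewrite mulrC.
Qed.

Theorem theorem3 (R : realType) (E : pmetricType R)
  (Q : R -> R.-pker (borel E) ~> (borel E))
  (pi : R -> probability (borel E) R)
  (g : R -> borel E -> R)
  (L r K Cg : R) (m : nat)
  (dO : nat -> measure_display) (Omega : forall n, measurableType (dO n))
  (P : forall n, probability (Omega n) R)
  (X : forall n, nat -> {RV (P n) >-> borel E})
  (gmeas : @measurable_fun _ _ (R * borel E)%type R
             (`[0, 1] `*` [set: borel E]) (fun z => g z.1 z.2))
  (L0 : 0 < L)
  (hi : forall u v : R, u \in `[0, 1] -> v \in `[0, 1] -> forall x,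
          (tv_dist (Q u x) (Q v x) <= (L * `|u - v|)%:E)%E)
  (m1 : (1 <= m)%N) (r01 : 0 < r < 1)
  (hii : forall u : R, u \in `[0, 1] -> forall x y,
          (tv_dist (kiter (Q u) m x) (kiter (Q u) m y) <= r%:E)%E)
  (hiii : forall u : R, u \in `[0, 1] -> forall x, `|g u x| <= K)
  (Cg0 : 0 <= Cg)
  (hiv : forall u v : R, u \in `[0, 1] -> v \in `[0, 1] -> forall x,
          `|g u x - g v x| <= Cg * `|u - v|)
  (hpi : forall u : R, u \in `[0, 1] -> invariant (Q u) (pi u))
  (hX : inhomogeneous_array Q (pi 0) X) :
  let Sn := array_sum g X in
  let b := \int[lebesgue_measure]_(u in `[0, 1]) smean pi g u in
  let a2 := avar Q pi g in
  let A2 := \int[lebesgue_measure]_(u in `[0, 1]) a2 u in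
  [/\ (n%:R^-1)%:E * 'E_(P n)[Sn n] @[n --> \oo] --> b%:E &
      ereal_sup [set `| 'E_(P n)[Sn n] - (n%:R * b)%:E |
                | n in [set n : nat | (1 <= n)%N]] < +oo]%E /\
  (forall u : R, u \in `[0, 1] ->
     cvgn (autocov_series Q pi g u) /\
     forall (dY : measure_display) (OY : measurableType dY)
       (PY : probability OY R) (Y : nat -> {RV PY >-> borel E}),
       stationary_chain (Q u) (pi u) Y ->
       ((n%:R^-1)%:E *
         'V_PY[fun w => (\sum_(1 <= j < n.+1) g u (Y j w))%R]
         @[n --> \oo] --> (a2 u)%:E)%E) /\
  [/\ (n%:R^-1)%:E * 'V_(P n)[Sn n] @[n --> \oo] --> A2%:E,
      ereal_sup [set `| 'V_(P n)[Sn n] - (n%:R * A2)%:E |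
                | n in [set n : nat | (1 <= n)%N]] < +oo &
      ereal_sup [set `| 'E_(P n)[fun w => ((Sn n w - b * n%:R) ^+ 2)%R]
                        - (n%:R * A2)%:E |
                | n in [set n : nat | (1 <= n)%N]] < +oo]%E /\
  ((exists2 delta : R, 0 < delta &
      forall u t : R, u \in `[0, 1] -> 0 < `|t| < delta ->
        (spectral_radius (twisted Q g u (0%R +i* t)%C) < 1)%E) \/
   (forall u t : R, u \in `[0, 1] -> t != 0 ->
        (spectral_radius (twisted Q g u (0%R +i* t)%C) < 1)%E) ->
   (forall u : R, u \in `[0, 1] -> 0 < a2 u) /\ 0 < A2).

Proof.
have [r0 r1] := andP r01.
pose cl := @clamp R.
have cin u : cl u \in `[0, 1] by exact: clamp_in.
have K0 : 0 <= K by apply: le_trans (hiii _ (cin 0) point).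
have bg u : u \in `[0, 1] -> bm (g u).
  move=> ui; split; last by exists K; exact: hiii _ ui.
  have mp : measurable_fun setT (fun x : borel E => (u, x) : (R * borel E)%type).
    exact: measurable_fun_pair.
  apply: (measurable_comp _ _ gmeas mp); first exact: measurableX.
  by move=> _ [x _ <-]; split => //; move: ui.
pose Q' u := Q (cl u); pose pi' u := pi (cl u); pose g' u := g (cl u).
have Qpi' u : invariant (Q' u) (pi' u) by exact: hpi.
have contract' u f (M : R) : bm f -> (forall x, `|f x| <= M) -> forall x y,
    `|iter m (kact (Q' u)) f x - iter m (kact (Q' u)) f y| <= r * M.
  move=> bf fM x y; have Q1 z : Q' u z setT = 1%E by exact: prob_kernel.
  rewrite -(kact_kiter Q1 m bf); apply: tv_dist_int => //; try exact: (kiter_setT Q1).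
  exact: hii.
have lipQ' u v f (M : R) : bm f -> (forall x, `|f x| <= M) -> forall x,
    `|kact (Q' u) f x - kact (Q' v) f x| <= L * `|u - v| * M.
  move=> bf fM x; apply: tv_dist_int => //; apply: le_trans (hi _ _ (cin u) (cin v) x) _.
  by rewrite lee_fin; apply: ler_wpM2l; [exact: ltW|exact: clamp_lip].
have lg' : lipfam (K + Cg) g'.
  split; first by move=> u; exact: bg.
  - by move=> u x; apply: le_trans (hiii _ (cin u) x) _; rewrite lerDl.
  - move=> u v x; apply: le_trans (hiv _ _ (cin u) (cin v) x) _.
    apply: ler_pM => //; [by rewrite lerDr|exact: clamp_lip].
have row' n : (1 <= n)%N -> forall k, (k < n)%N ->
    markov_step (X n) k (Q' (k.+1%:R / n%:R)).
  move=> n0 k kn; rewrite /Q' /cl clamp_id; last exact: ratio_in.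
  by have [_] := hX _ n0; apply.
have L0' := ltW L0; have r0' := ltW r0.
have avE u : avar Q' pi' g' u = avar Q pi g (cl u) by [].
move=> Sn b a2 A2.
have bE : b = \int[lebesgue_measure]_(u in `[0, 1]) smean pi' g' u.
  apply: eq_Rintegral => u ui; rewrite -[RHS]/(smean pi g (cl u)) /cl clamp_id//.
  by move: ui; rewrite inE.
have A2E : A2 = \int[lebesgue_measure]_(u in `[0, 1]) avar Q' pi' g' u.
  apply: eq_Rintegral => u ui; rewrite avE /cl clamp_id//.
  by move: ui; rewrite inE.
have SE n : (1 <= n)%N -> array_sum g' X (n:=n) = Sn n.
  move=> n0; apply/funext => w; apply: eq_big_nat => k /andP[k1 kn].
  have kin : (k%:R / n%:R : R) \in `[0, 1] by exact: ratio_in.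
  rewrite /g' /cl (clamp_id kin); reflexivity.
have [[c1 s1] [c2 s2 s3]] := array_moments Qpi' L0' m1 r0' r1 contract' lipQ' lg' row'.
split; [split|split; [|split; [split|]]].
- by rewrite bE; apply: eq_cvg_pos c1 => n n1; rewrite SE.
- rewrite bE; move: s1; congr (_ < _)%E; congr ereal_sup; apply: eq_image_pos => n n1.
  by rewrite SE.
- move=> u ui; have clu : cl u = u by exact: clamp_id.
  have [cv _] := avarE Qpi' L0' m1 r0' r1 contract' lipQ' u lg'.
  split; first by move: cv; rewrite -[autocov_series _ _ _ _]/(autocov_series Q pi g (cl u)) clu.
  move=> dY OY PY Y [_ st].
  (* The stationary chain is treated as an array with a constant family, Lipschitz constant 0 and
     the same chain in every row; integrating the constant [a2 u] over the unit interval returns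
     it. *)
  have lgu : lipfam K (fun _ : R => g u).
    split; first by move=> _; exact: bg.
    - by move=> _ x; exact: hiii.
    - by move=> v w x; rewrite subrr normr0 mulr_ge0.
  have lipu (v w : R) f (M : R) : bm f -> (forall x, `|f x| <= M) -> forall x,
      `|kact (Q u) f x - kact (Q u) f x| <= 0 * `|v - w| * M.
    by move=> _ _ x; rewrite subrr normr0 !mul0r.
  have cu (v : R) f (M : R) : bm f -> (forall x, `|f x| <= M) -> forall x y,
      `|iter m (kact (Q u)) f x - iter m (kact (Q u)) f y| <= r * M.
    by have := contract' u f M; rewrite /Q' clu.
  have [_ [c _ _]] := @array_moments _ _ R (fun _ => Q u) (fun _ => pi u) 0 r m
    (fun _ => hpi _ ui) (lexx 0) m1 r0' r1 cu lipu _ _ lgu (fun _ => dY) (fun _ => OY)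
    (fun _ => PY) (fun _ => Y) (fun n _ k _ => st k).
  have e : \int[lebesgue_measure]_(v in `[0, 1])
      avar (fun _ : R => Q u) (fun _ => pi u) (fun _ => g u) v = a2 u.
    exact: (unit_integral_cst (a2 u)).
  by rewrite -e; exact: c.
- by rewrite A2E; apply: eq_cvg_pos c2 => n n1; rewrite SE.
- rewrite A2E; move: s2; congr (_ < _)%E; congr ereal_sup; apply: eq_image_pos => n n1.
  by rewrite SE.
- rewrite A2E bE; move: s3; congr (_ < _)%E; congr ereal_sup; apply: eq_image_pos => n n1.
  by rewrite SE.
- move=> spec.
  (* One nonzero t is enough, and the same one serves all u: delta / 2 under the local condition, 1
     under the global one. *)
  have [t ht] : exists t : R, forall u : R, u \in `[0, 1] ->
      (spectral_radius (twisted Q g u (0%R +i* t)%C) < 1)%E.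
    case: spec => [[delta d0 h]|h].
      by exists (delta / 2) => u ui; exact: (h _ _ ui (half_norm d0)).
    by exists 1 => u ui; exact: (h _ _ ui (oner_neq0 R)).
  have avar_gt0 u : u \in `[0, 1] -> 0 < a2 u.
    move=> ui; have clu : cl u = u by exact: clamp_id.
    rewrite ltNge; apply/negP => a0.
    have [bF FM _] := lipfam_cent Qpi' L0' m1 r0' r1 contract' lipQ' lg'.
    have F0 := int_cent pi' u lg'.
    have bh := bm_poisson (Qpi' u) m1 r0' r1 (contract' u) (bF u) (FM u) F0.
    have heq := poisson_eq (Qpi' u) m1 r0' r1 (contract' u) (bF u) (FM u) F0.
    have [_ av] := avarE Qpi' L0' m1 r0' r1 contract' lipQ' u lg'.
    have a0' : \int[pi' u]_x mvar Q' pi' g' u x <= 0 by rewrite -av avE clu.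
    have := @twisted_spectrum _ _ _ Q' (pi' u) g' u t _ (smean pi' g' u) (Qpi' u)
      (bg _ (cin u)) bh heq a0'.
    rewrite -[twisted _ _ _ _]/(twisted Q g (cl u) (0%R +i* t)%C) clu => sp.
    have := ht u ui; rewrite ltNge => /negP; apply.
    by apply: ereal_sup_ubound; eexists; [exact: sp|rewrite nc_cis].
  split; first exact: avar_gt0.
  have [C' lav] := avar_lip Qpi' L0' m1 r0' r1 contract' lipQ' lg'.
  rewrite A2E; apply: (lip_integral_gt0 lav) => u.
  by rewrite avE; exact: avar_gt0.
Qed.
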